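(* Let $q\in\mathbb C$ with $|q|>1$, let $t$ be a prime number and $\zeta$ a primitive $t$-th root of unity. Let $\mathcal M$ be the field of meromorphic functions on $\mathbb C^*$, let $\kappa=\{g\in\mathcal M: g(qz)=g(z)\}$, and let $\kappa(z)\subseteq\mathcal M$ be the subfield generated by $\kappa$ and $z$. Let $\theta_q(z)=-\sum_{n\in\mathbb Z}(-1)^nq^{-n(n-1)/2}z^n$. If $\lambda_0\in\kappa(z)$ and $\lambda_{jd}\in\kappa(z)$ ($0\le j\le t-1$, $1\le d\le t-1$) satisfy $$\lambda_0+\sum_{d=1}^{t-1}\Bigl(\lambda_{0d}\,\theta_q(z)^d+\lambda_{1d}\,\theta_q(\zeta z)^d+\dots+\lambda_{t-1,d}\,\theta_q(\zeta^{t-1}z)^d\Bigr)=0,$$ then $\lambda_0=0$ and $\lambda_{jd}=0$ for all $j,d$.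
   Context: $\theta_q$ is a meromorphic (indeed holomorphic) function on $\mathbb C^*$ satisfying $\theta_q(qz)=-qz\,\theta_q(z)$. *)

(* Defs.v *)
From HB Require Import structures.
From mathcomp Require Import all_boot all_order all_algebra.
From mathcomp Require Import all_classical all_reals all_analysis.
From mathcomp Require Import complex.
Export Order.TTheory GRing.Theory Num.Theory.
Export numFieldNormedType.Exports.

Set Implicit Arguments.
Unset Strict Implicit.
Unset Printing Implicit Defensive.

Local Open Scope classical_set_scope.
Local Open Scope ring_scope.

(* The complex numbers over a real field R : realType, viewed as a normed
   space over itself (so that [derivable f z 1] is complex differentiability). *)
Notation Cplx R := ((R[i])^o).

Definition discrete_in_Cstar (R : realType) (S : set (Cplx R)) : Prop :=
  S `<=` [set z | z != 0] /\
  forall w : Cplx R, w != 0 ->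
    exists2 r : Cplx R, 0 < r &
      forall s, S s -> `|s - w| < r -> s = w.

Definition holo_at (R : realType) (f : Cplx R -> Cplx R) (z : Cplx R) : Prop :=
  derivable f z 1.

(* f is meromorphic on C^* : holomorphic off a discrete set S of C^*,
   and each point of S is a pole (not an essential singularity):
   (z - a)^k f(z) stays bounded near a for some k. The values of f at the
   points of S are irrelevant. *)
Definition meromorphic (R : realType) (f : Cplx R -> Cplx R) : Prop :=
  exists S : set (Cplx R),
    [/\ discrete_in_Cstar S,
        (forall z, z != 0 -> ~ S z -> holo_at f z) &
        (forall a, S a -> exists k : nat, exists2 r : Cplx R, 0 < r &
            exists M : Cplx R, forall z, 0 < `|z - a| < r ->
              `|(z - a) ^+ k * f z| <= M)].

(* equality in the field M of meromorphic functions on C^*: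
   equality away from a discrete subset of C^* *)
Definition meq (R : realType) (f g : Cplx R -> Cplx R) : Prop :=
  exists S : set (Cplx R), discrete_in_Cstar S /\
    forall z, z != 0 -> ~ S z -> f z = g z.

Definition in_kappa (R : realType) (q : Cplx R) (g : Cplx R -> Cplx R) : Prop :=
  meromorphic g /\ meq (fun z => g (q * z)) g.

Definition polyexpr (R : realType) (n : nat) (a : nat -> Cplx R -> Cplx R)
  : Cplx R -> Cplx R :=
  fun z => \sum_(i < n) a i z * z ^+ i.

(* lam belongs to kappa(z), the subfield of M generated by kappa and z,
   i.e. lam = A(z)/B(z) in M with A, B polynomial expressions in z with
   coefficients in kappa and B <> 0 in M. *)
Definition in_kappa_z (R : realType) (q : Cplx R) (lam : Cplx R -> Cplx R) : Prop :=
  exists n : nat, exists a b : nat -> Cplx R -> Cplx R,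
    [/\ forall i, in_kappa q (a i),
        forall i, in_kappa q (b i),
        ~ meq (polyexpr n b) (fun _ => 0) &
        meq lam (fun z => polyexpr n a z / polyexpr n b z)].

(* symmetric partial sums of sum_{n in Z} (-1)^n q^{-n(n-1)/2} z^n :
   terms with -N < n < N; for n = -m, q^{-n(n-1)/2} = q^{-m(m+1)/2}. *)
Definition theta_partial (R : realType) (q z : Cplx R) (N : nat) : Cplx R :=
  \sum_(0 <= n < N) ((-1) ^+ n * q ^- (n * n.-1)./2 * z ^+ n)
  + \sum_(1 <= m < N) ((-1) ^+ m * q ^- (m * m.+1)./2 * z ^- m).

Definition theta (R : realType) (q z : Cplx R) : Cplx R :=
  - lim (theta_partial q z @ \oo).

(* Main.v *)
(** For [z] outside a meagre set, the relation may be evaluated along the orbit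
    [X n = q^n z], where the coefficients in [kappa(z)] become rational functions
    of [X n] and [theta(zeta^j q^n z) = zeta^(j n) w n theta(zeta^j z)] with
    [w n = (-1)^n q^(n(n+1)/2) z^n] growing faster than every power of [X n].
    On a residue class of [n] modulo [t] the relation is a polynomial in [w n]
    with coefficients rational in [X n], so all of these vanish; inverting the
    discrete Fourier transform in the residue ([zeta^d] is again primitive because
    [t] is prime) gives [lam j d z * theta(zeta^j z)^d = 0] for generic [z].
    A nonzero [lam j d] would be nonzero near some point, so [theta] would vanish
    generically on an open set; this is excluded by a finite combination of values
    of [theta] along a geometric progression that isolates the constant Laurent
    coefficient, rather than by the identity theorem. *)
Require Import Defs.
From HB Require Import structures.
From mathcomp Require Import all_boot all_order all_algebra.
From mathcomp Require Import all_classical all_reals all_analysis.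
From mathcomp Require Import complex ring lra zify.

Set Implicit Arguments.
Unset Strict Implicit.
Unset Printing Implicit Defensive.

Local Open Scope classical_set_scope.
Local Open Scope ring_scope.

(** * Growth of rational functions along a sequence tending to infinity *)

Section RationalSequences.
Variables (F : numFieldType) (X : nat -> F).
Hypothesis Xoo : forall M : F, 0 <= M -> \forall n \near \oo, M <= `|X n|.

(** The constant is the modulus of the leading coefficient: once [|X n| >= 1 + |a| / c], the Horner
    step [p * 'X + a] preserves the lower bound [c]. *)
Lemma horner_lower_bound (p : {poly F}) : p != 0 ->
  exists2 c : F, 0 < c & \forall n \near \oo, c <= `|p.[X n]|.
Proof.
elim/poly_ind: p => [|p a IH]; first by rewrite eqxx.
have [->|p0 _] := eqVneq p 0.
  rewrite mul0r add0r polyC_eq0 => a0; exists `|a|; first by rewrite normr_gt0.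
  by near=> n; rewrite hornerC.
have [c c0 cP] := IH p0.
exists c => //; near=> n.
have h1 : c <= `|p.[X n]| by near: n.
have h2 : 1 + `|a| / c <= `|X n|.
  by near: n; apply: Xoo; rewrite addr_ge0 // divr_ge0 // ltW.
rewrite hornerMXaddC.
apply: (@le_trans _ _ (`|p.[X n] * X n| - `|a|)); last first.
  by apply: le_trans (lerB_normD _ _).
rewrite lerBrDr normrM.
have -> : c + `|a| = c * (1 + `|a| / c).
  by rewrite mulrDr mulr1 mulrCA divff ?gt_eqF// mulr1.
apply: ler_pM => //; first exact: ltW.
by rewrite addr_ge0 // divr_ge0 // ltW.
Unshelve. all: by end_near. Qed.

Lemma horner_upper_bound (p : {poly F}) :
  exists C k, 0 <= C /\ \forall n \near \oo, `|p.[X n]| <= C * `|X n| ^+ k.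
Proof.
elim/poly_ind: p => [|p a [C [k [C0 IH]]]].
  by exists 0, 0%N; split => //; near=> n; rewrite horner0 normr0 mul0r.
exists (C + `|a|), k.+1; split; first by rewrite addr_ge0.
near=> n.
have h1 : `|p.[X n]| <= C * `|X n| ^+ k by near: n.
have h2 : 1 <= `|X n| by near: n; apply: Xoo.
rewrite hornerMXaddC (le_trans (ler_normD _ _)) // mulrDl lerD //.
  by rewrite normrM exprSr mulrA ler_wpM2r.
by rewrite ler_peMr // exprn_ege1.
Unshelve. all: by end_near. Qed.

Lemma horner_freq0 (p : {poly F}) :
  (forall N, exists2 n, (N <= n)%N & p.[X n] = 0) -> p = 0.
Proof.
move=> h; apply/eqP; apply: contraT => /horner_lower_bound [c c0 [N _ NP]].
have [n Nn pn] := h N; have := NP n Nn.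
by rewrite /= pn normr0 lt_geF.
Qed.

(** Equality is only asked eventually, past the zeros of the denominators, so that the class is
    closed under sums. *)
Definition rat_seq (u : nat -> F) := exists A B : {poly F},
  B != 0 /\ \forall n \near \oo, u n = A.[X n] / B.[X n].

Lemma rat_seq0 : rat_seq (fun=> 0).
Proof.
exists 0, 1; split; first exact: oner_neq0.
by near=> n; rewrite horner0 mul0r.
Unshelve. all: by end_near. Qed.

Lemma rat_seqD u v : rat_seq u -> rat_seq v -> rat_seq (fun n => u n + v n).
Proof.
move=> [A [B [B0 uP]]] [A' [B' [B'0 vP]]].
exists (A * B' + A' * B), (B * B'); split; first by rewrite mulf_neq0.
have [c c0 cP] := horner_lower_bound B0.
have [c' c'0 c'P] := horner_lower_bound B'0.
near=> n.
have -> : u n = A.[X n] / B.[X n] by near: n.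
have -> : v n = A'.[X n] / B'.[X n] by near: n.
have b0 : B.[X n] != 0.
  by rewrite -normr_gt0 (lt_le_trans c0) //; near: n.
have b'0 : B'.[X n] != 0.
  by rewrite -normr_gt0 (lt_le_trans c'0) //; near: n.
by rewrite !hornerE addf_div.
Unshelve. all: by end_near. Qed.

Lemma rat_seqZ c u : rat_seq u -> rat_seq (fun n => c * u n).
Proof.
move=> [A [B [B0 uP]]]; exists (c *: A), B; split => //.
near=> n.
have -> : u n = A.[X n] / B.[X n] by near: n.
by rewrite hornerZ mulrA.
Unshelve. all: by end_near. Qed.

Lemma rat_seq_sum (u : nat -> nat -> F) m :
  (forall j, (j < m)%N -> rat_seq (u j)) ->
  rat_seq (fun n => \sum_(j < m) u j n).
Proof.
elim: m => [|m IH] h.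
  have -> : (fun n => \sum_(j < 0) u j n) = (fun=> 0).
    by apply/funext => n; rewrite big_ord0.
  exact: rat_seq0.
have -> : (fun n => \sum_(j < m.+1) u j n) = fun n => \sum_(j < m) u j n + u m n.
  by apply/funext => n; rewrite big_ord_recr.
apply: rat_seqD; last exact: h.
by apply: IH => j jm; apply: h; rewrite ltnS ltnW.
Qed.

(** A nonzero numerator stays away from 0 and the denominator grows at most polynomially, so the
    decay is at most polynomial. *)
Lemma rat_seq_lower u : rat_seq u ->
  (\forall n \near \oo, u n = 0) \/
  exists c k, 0 < c /\ \forall n \near \oo, c <= `|u n| * `|X n| ^+ k.
Proof.
move=> [A [B [B0 uP]]]; have [A0|A0] := eqVneq A 0.
  left; near=> n.
  have -> : u n = A.[X n] / B.[X n] by near: n.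
  by rewrite A0 horner0 mul0r.
right.
have [b b0 bP] := horner_lower_bound B0.
have [a a0 aP] := horner_lower_bound A0.
have [C [k [C0 CP]]] := horner_upper_bound B.
have C1 : 0 < C + 1 by rewrite ltr_wpDl.
exists (a / (C + 1)), k; split; first by rewrite divr_gt0.
near=> n.
have -> : u n = A.[X n] / B.[X n] by near: n.
have Bn : 0 < `|B.[X n]| by rewrite (lt_le_trans b0) //; near: n.
rewrite normrM normfV ler_pdivrMr //.
have h : `|B.[X n]| <= C * `|X n| ^+ k by near: n.
have h2 : a <= `|A.[X n]| by near: n.
have -> : `|A.[X n]| / `|B.[X n]| * `|X n| ^+ k * (C + 1) =
   `|A.[X n]| * ((C + 1) * `|X n| ^+ k / `|B.[X n]|) by ring.
rewrite -[leLHS]mulr1 ler_pM // ?(ltW a0) //.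
rewrite ler_pdivlMr // mul1r (le_trans h) // ler_wpM2r ?exprn_ge0 //.
by rewrite lerDl.
Unshelve. all: by end_near. Qed.

Lemma rat_seq_upper u : rat_seq u ->
  exists C k, 0 <= C /\ \forall n \near \oo, `|u n| <= C * `|X n| ^+ k.
Proof.
move=> [A [B [B0 uP]]].
have [b b0 bP] := horner_lower_bound B0.
have [C [k [C0 CP]]] := horner_upper_bound A.
exists (C / b), k; split; first by rewrite divr_ge0 // ltW.
near=> n.
have -> : u n = A.[X n] / B.[X n] by near: n.
have hb : b <= `|B.[X n]| by near: n.
have Bn : 0 < `|B.[X n]| by rewrite (lt_le_trans b0).
have h : `|A.[X n]| <= C * `|X n| ^+ k by near: n.
rewrite normrM normfV mulrAC ler_pM //.
by rewrite lef_pV2.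
Unshelve. all: by end_near. Qed.

Lemma rat_seq_common_upper (u : nat -> nat -> F) m :
  (forall j, (j < m)%N -> rat_seq (u j)) ->
  exists C k, 0 <= C /\ \forall n \near \oo,
    forall j, (j < m)%N -> `|u j n| <= C * `|X n| ^+ k.
Proof.
elim: m => [|m IH] h; first by exists 0, 0%N; split => //; near=> n.
have [|C [k [C0 CP]]] := IH; first by move=> j jm; apply: h; rewrite ltnS ltnW.
have [C' [k' [C'0 C'P]]] := rat_seq_upper (h m (ltnSn m)).
exists (C + C'), (k + k')%N; split; first by rewrite addr_ge0.
near=> n => j; rewrite ltnS leq_eqVlt.
have h2 : 1 <= `|X n| by near: n; apply: Xoo.
case/orP => [/eqP->|jm].
  have /le_trans -> // : `|u m n| <= C' * `|X n| ^+ k' by near: n.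
  by rewrite ler_pM ?exprn_ge0 ?lerDr // ler_weXn2l // leq_addl.
have /(_ j jm)/le_trans -> // : forall j, (j < m)%N -> `|u j n| <= C * `|X n| ^+ k.
  by near: n.
by rewrite ler_pM ?exprn_ge0 ?lerDl // ler_weXn2l // leq_addr.
Unshelve. all: by end_near. Qed.

Variable w : nat -> F.
Hypothesis woo : forall M k, 0 <= M ->
  \forall n \near \oo, M * `|X n| ^+ k <= `|w n|.

(** Induction from the top degree: if [u D] is not eventually 0, it decays at most polynomially, and
    at large [n] in [P] the relation bounds [|w n|] by a power of [|X n|], against [woo]. The
    dichotomy [rat_seq_lower] extends the vanishing from [P] to all large [n]. *)
Lemma rat_seq_indep (u : nat -> nat -> F) (P : set nat) D :
  (forall d, (d < D)%N -> rat_seq (u d)) ->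
  (forall N, exists2 n, (N <= n)%N & P n) ->
  (\forall n \near \oo, P n -> \sum_(d < D) u d n * w n ^+ d = 0) ->
  forall d, (d < D)%N -> \forall n \near \oo, u d n = 0.
Proof.
move=> + Pfreq; elim: D => [//|D IH] urat urel.
have uD : \forall n \near \oo, u D n = 0.
  have [//|[c [k [c0 cP]]]] := rat_seq_lower (urat D (ltnSn D)).
  have [|C [l [C0 CP]]] := @rat_seq_common_upper u D.
    by move=> j jm; apply: urat; rewrite ltnS ltnW.
  exfalso.
  (* With this constant [c * |w n|] is at least [(D * C + 1) * |X n| ^ (l + k)], strictly above the
     bound [D * C * |X n| ^ (l + k)] that the relation gives. *)
  have M0 : 0 <= (D%:R * C + 1) / c.
    by rewrite divr_ge0 ?(ltW c0) // addr_ge0 // mulr_ge0.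
  have : \forall n \near \oo, ~ P n.
    near=> n => Pn.
    have X1 : 1 <= `|X n| by near: n; apply: Xoo.
    have hl : c <= `|u D n| * `|X n| ^+ k by near: n.
    have hu : forall j, (j < D)%N -> `|u j n| <= C * `|X n| ^+ l by near: n.
    have hw : (D%:R * C + 1) / c * `|X n| ^+ (l + k) <= `|w n|.
      by near: n; apply: woo.
    have hw1 : 1 <= `|w n|.
      suff : 1 * `|X n| ^+ 0 <= `|w n| by rewrite expr0 mulr1.
      by near: n; apply: woo.
    have : P n -> \sum_(d < D.+1) u d n * w n ^+ d = 0 by near: n.
    rewrite big_ord_recr /= => /(_ Pn).
    move/eqP; rewrite addr_eq0 => /eqP /(congr1 Num.norm).
    rewrite normrN normrM normrX => e.
    (* For [D = 0] there are no lower terms, and the relation reads [u 0 n = 0]. *)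
    have [D0|D0] := posnP D.
      move: e hl; rewrite D0 big_ord0 normr0 expr0 mulr1 => <-.
      by rewrite mul0r lt_geF.
    have {e} : `|u D n| * `|w n| ^+ D <= D%:R * (C * `|X n| ^+ l * `|w n| ^+ D.-1).
      rewrite -e (le_trans (ler_norm_sum _ _ _)) //.
      apply: (@le_trans _ _ (\sum_(i < D) (C * `|X n| ^+ l * `|w n| ^+ D.-1))).
        apply: ler_sum => i _; rewrite normrM normrX ler_pM ?exprn_ge0 //.
          exact: hu.
        by rewrite ler_weXn2l // -ltnS prednK.
      by rewrite sumr_const card_ord mulr_natl.
    have -> : `|w n| ^+ D = `|w n| * `|w n| ^+ D.-1 by rewrite -exprS prednK.
    rewrite !mulrA ler_pM2r; last first.
      by rewrite exprn_gt0 // (lt_le_trans ltr01).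
    move=> e.
    have : c * `|w n| <= D%:R * C * `|X n| ^+ l * `|X n| ^+ k.
      apply: (@le_trans _ _ (`|u D n| * `|w n| * `|X n| ^+ k)).
        by rewrite mulrAC ler_wpM2r.
      by rewrite ler_wpM2r // exprn_ge0.
    rewrite -mulrA -exprD; apply/negP; rewrite -real_ltNge ?num_real //; last first.
    - by rewrite realM // ?gtr0_real // ger0_real.
    - by rewrite ger0_real // !mulr_ge0 // exprn_ge0.
    apply: (@lt_le_trans _ _ (c * ((D%:R * C + 1) / c * `|X n| ^+ (l + k)))); last first.
      by rewrite ler_pM2l.
    rewrite mulrA mulrCA divff ?gt_eqF// mulr1 mulrDl mul1r ltrDl.
    by rewrite exprn_gt0 // (lt_le_trans ltr01).
  by move=> [N _ NP]; have [n Nn Pn] := Pfreq N; exact: (NP n Nn Pn).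
move=> d; rewrite ltnS leq_eqVlt => /orP[/eqP-> //|dD].
apply: IH => // [e eD|]; first by apply: urat; rewrite ltnS ltnW.
near=> n => Pn.
have e0 : u D n = 0 by near: n.
have : P n -> \sum_(d < D.+1) u d n * w n ^+ d = 0 by near: n.
by rewrite big_ord_recr /= e0 mul0r addr0; apply.
Unshelve. all: by end_near. Qed.

End RationalSequences.

(** * Inversion of the discrete Fourier transform *)

(** Orthogonality of characters: for [t] prime and [0 < d < t], [zeta ^ (k d) = 1] exactly when [t]
    divides [k]. Summing the relations against [zeta ^ ((t - i) r d)], where [t - i] replaces [- i]
    to stay in [nat], leaves [t * mu i]. *)
Lemma prim_root_dft_inj (F : numFieldType) (t d : nat) (zeta : F) (mu : nat -> F) :
  prime t -> t.-primitive_root zeta -> (0 < d < t)%N ->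
  (forall r, (r < t)%N -> \sum_(j < t) zeta ^+ (j * r * d) * mu j = 0) ->
  forall j, (j < t)%N -> mu j = 0.
Proof.
move=> pt zt /andP[d0 dt] h i it.
have t0 : (0 < t)%N by apply: prime_gt0.
have geo (k : nat) : \sum_(r < t) (zeta ^+ (k * d)) ^+ r =
    if (t %| k)%N then t%:R else 0.
  case: ifPn => tk.
    have -> : zeta ^+ (k * d) = 1.
      by apply/eqP; rewrite -(prim_order_dvd zt) dvdn_mulr.
    under eq_bigr do rewrite expr1n.
    by rewrite sumr_const card_ord.
  have z1 : zeta ^+ (k * d) != 1.
    rewrite -(prim_order_dvd zt) Euclid_dvdM // negb_or tk /=.
    by rewrite gtnNdvd.
  apply/eqP; rewrite -(mulrI_eq0 _ (mulfI (_ : zeta ^+ (k * d) - 1 != 0))).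
    by rewrite -subrX1 -exprM [(_ * t)%N]mulnC exprM (prim_expr_order zt) expr1n subrr.
  by rewrite subr_eq0.
have : \sum_(r < t) zeta ^+ ((t - i) * r * d) *
   (\sum_(j < t) zeta ^+ (j * r * d) * mu j) = 0.
  by rewrite big1 // => r _; rewrite h // mulr0.
under eq_bigr do rewrite mulr_sumr.
rewrite exchange_big /=.
under eq_bigr => j _.
  under eq_bigr => r _.
    rewrite mulrA -exprD -mulnDl -mulnDl -mulnA [(r * d)%N]mulnC mulnA exprM.
    over.
  rewrite -mulr_suml geo.
  over.
rewrite (bigD1 (Ordinal it)) //= subnK ?(ltnW it) // dvdnn big1 ?addr0.
  by move/eqP; rewrite mulf_eq0 pnatr_eq0 gtn_eqF //= => /eqP.
move=> j ji; rewrite ifN ?mul0r //.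
(* A multiple of [t] strictly between 0 and [2 * t] is [t] itself, which would force [j = i]. *)
apply/negP => /dvdnP[c e].
have ij : (i <> j)%N by move=> ij; case/eqP: ji; apply: val_inj.
have jt := ltn_ord j.
have : (0 < c * t < 2 * t)%N by rewrite -e; apply/andP; split; lia.
rewrite muln_gt0 t0 andbT ltn_pmul2r // => c2.
have c1 : c = 1%N by lia.
by move: e; rewrite c1; lia.
Qed.

(** * Gaussian decay against exponential growth *)

Section GaussianDecay.
Variable R : realType.

Lemma bernoulli_le (a : R) n : 0 <= a -> 1 + n%:R * a <= (1 + a) ^+ n.
Proof.
move=> a0; elim: n => [|n IH]; first by rewrite mul0r addr0 expr0.
rewrite exprS.
apply: (@le_trans _ _ ((1 + a) * (1 + n%:R * a))); last first.
  by rewrite ler_wpM2l // addr_ge0.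
rewrite -natr1; have : 0 <= n%:R * a ^+ 2 by rewrite mulr_ge0 // exprn_ge0.
by move: (n%:R : R) => m h; nra.
Qed.

(** A converse to Bernoulli: for [n a < 1] it bounds [(1 + a) ^ n] by [1 / (1 - n a)]. The induction
    rests on [(1 - (n + 1) a) (1 + a) <= 1 - n a]. *)
Lemma exprn1D_upper (a : R) n : 0 <= a -> (1 - n%:R * a) * (1 + a) ^+ n <= 1.
Proof.
move=> a0; elim: n => [|n IH]; first by rewrite mul0r subr0 expr0 mulr1.
rewrite exprS mulrA.
apply: (le_trans _ IH); rewrite ler_wpM2r ?exprn_ge0 ?addr_ge0 //.
have : 0 <= n%:R * a ^+ 2 by rewrite mulr_ge0 // exprn_ge0.
by rewrite -natr1; move: (n%:R : R) => m h; nra.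
Qed.

Lemma natr_unbounded (x : R) : exists n : nat, x <= n%:R.
Proof.
exists (Num.bound `|x|); rewrite (le_trans (ler_norm x)) // ltW //.
by rewrite archi_boundP.
Qed.

(* [K^3 u^(3K)] stays bounded for [u < 1], so that [K^2 u^(3K)] tends to [0];
   the Gaussian factor absorbs [(M K^2)^K] because [n - 1 >= K]. *)
Lemma gauss_absorbs (q C M : R) : 1 < q -> 0 <= C -> 1 <= M ->
  exists2 K, (0 < K)%N & forall n, (K < n)%N ->
    (M * K%:R ^+ 2) ^+ K * (C ^+ n * q ^- (n * n.-1)./2) <= 8^-1 ^+ n.
Proof.
move=> q1 C0 M1.
(* [exprn1D_upper] suggests [6 h = 1 - 1 / q]. With [u = 1 / (1 + h)] the exponent 6 bounds
   [q ^ (- n (n - 1) / 2)] by [u ^ (3 n (n - 1))], hence by [(u ^ (3 K)) ^ n]. *)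
have [h h0 hq] : exists2 h : R, 0 < h & (1 + h) ^+ 6 <= q.
  have q0 : 0 < q by lra.
  have qi : q * q^-1 = 1 by rewrite divff ?gt_eqF.
  have qi1 : q^-1 < 1 by rewrite invf_lt1.
  exists ((1 - q^-1) / 6); first by lra.
  have := @exprn1D_upper ((1 - q^-1) / 6) 6.
  have -> : 1 - 6%:R * ((1 - q^-1) / 6) = q^-1 by move: (q^-1) => i; lra.
  move=> /(_ ltac:(lra)) h.
  by rewrite mulrC ler_pdivrMr // mul1r in h.
have h1 : 0 < 1 + h by lra.
have [K HK] := natr_unbounded (1 + 8 * C * M / h ^+ 3).
have K1 : 1 <= K%:R :> R.
  apply: le_trans HK; rewrite lerDl !mulr_ge0 //; first by lra.
  by rewrite invr_ge0 exprn_ge0 // ltW.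
have K0 : (0 < K)%N by rewrite -(ltr_nat R); lra.
exists K => // n Kn.
pose u := (1 + h)^-1.
have u0 : 0 < u by rewrite invr_gt0.
have u1 : u <= 1 by rewrite invf_le1 //; lra.
have Ku : K%:R * u ^+ K <= h^-1.
  rewrite exprVn ler_pdivrMr ?exprn_gt0 // ler_pdivlMl //.
  by apply: le_trans (bernoulli_le _ (ltW h0)); rewrite mulrC lerDr.
have qu : q ^- (n * n.-1)./2 <= (u ^+ (3 * K)) ^+ n.
  apply: (@le_trans _ _ ((u ^+ 6) ^+ (n * n.-1)./2)).
    have q1u : q^-1 <= u ^+ 6 by rewrite exprVn lef_pV2 // posrE ?exprn_gt0 //; lra.
    rewrite -exprVn lerXn2r // nnegrE ?exprn_ge0 ?(ltW u0) //.
    by rewrite invr_ge0; lra.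
  rewrite -!exprM ler_wiXn2l ?(ltW u0) //.
  have e : ((n * n.-1)./2).*2 = (n * n.-1)%N.
    case: n {Kn} => // m /=; rewrite -[RHS]odd_double_half.
    by rewrite oddM /= andNb.
  have -> : (6 * (n * n.-1)./2 = 3 * ((n * n.-1)./2).*2)%N by rewrite -mul2n mulnA.
  rewrite e [(n * n.-1)%N]mulnC.
  by rewrite -mulnA leq_mul2l /= leq_mul2r orbC -ltnS prednK ?Kn // (leq_ltn_trans _ Kn).
have MK : 1 <= M * K%:R ^+ 2.
  by rewrite -[leLHS]mulr1 ler_pM // exprn_ege1.
(* Multiplied by [K], the left side is [M C (K u ^ K) ^ 3], at most [M C / h ^ 3] by [Ku]; [K] was
   chosen to make this at most [K / 8]. *)
have small : M * K%:R ^+ 2 * (C * u ^+ (3 * K)) <= 8^-1.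
  have e : (K%:R * u ^+ K) ^+ 3 <= h^-1 ^+ 3.
    rewrite lerXn2r // nnegrE ?invr_ge0 ?(ltW h0) // mulr_ge0 //.
    by rewrite exprn_ge0 ?(ltW u0).
  rewrite -(ler_pM2l (_ : 0 < K%:R)); last by lra.
  have -> : K%:R * (M * K%:R ^+ 2 * (C * u ^+ (3 * K))) =
    M * C * (K%:R * u ^+ K) ^+ 3 by rewrite mulnC exprM; ring.
  apply: (@le_trans _ _ (M * C * h^-1 ^+ 3)).
    by rewrite ler_wpM2l // mulr_ge0 //; lra.
  by rewrite exprVn; lra.
(* As [M K ^ 2 >= 1] and [K < n], its exponent [K] may be raised to [n], which makes the whole an
   [n]-th power. *)
apply: (@le_trans _ _ ((M * K%:R ^+ 2 * (C * u ^+ (3 * K))) ^+ n)).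
  rewrite [leRHS]exprMn ler_pM ?exprn_ge0 ?mulr_ge0 ?exprn_ge0 ?invr_ge0 //; try lra.
  - by rewrite exprn_ge0; lra.
  - by rewrite ler_weXn2l // ltnW.
  - by rewrite exprMn ler_wpM2l // exprn_ge0.
rewrite lerXn2r // nnegrE ?invr_ge0 // !mulr_ge0 ?exprn_ge0 ?(ltW u0) //; lra.
Qed.

End GaussianDecay.

(** * Real-valued modulus and dominated convergence of complex series *)

Section ComplexModulus.
Variable R : realType.
Implicit Types (z w : Cplx R).

(** The norm of [R[i]] takes its values in [R[i]]; this copy lives in [R], where the order is total
    and [lra] and [nra] apply. *)
Definition cabs z : R := Re (`|z| : R[i]).

Lemma cabsE z : `|z| = (cabs z)%:C%C.
Proof. by rewrite /cabs RRe_real // normr_real. Qed.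

Lemma cabs_ge0 z : 0 <= cabs z.
Proof. by rewrite -lecR -cabsE normr_ge0. Qed.

Lemma cabs_gt0 z : (0 < cabs z) = (z != 0).
Proof. by rewrite -ltcR -cabsE normr_gt0. Qed.

Lemma cabs0 : cabs 0 = 0.
Proof. by rewrite /cabs normr0. Qed.

Lemma cabs1 : cabs 1 = 1.
Proof. by rewrite /cabs normr1. Qed.

Lemma cabsN z : cabs (- z) = cabs z.
Proof. by rewrite /cabs normrN. Qed.

Lemma cabsM z w : cabs (z * w) = cabs z * cabs w.
Proof. by apply: (@complexI R); rewrite rmorphM /= -!cabsE normrM. Qed.

Lemma cabsX z n : cabs (z ^+ n) = cabs z ^+ n.
Proof. by apply: (@complexI R); rewrite rmorphXn /= -!cabsE normrX. Qed.

Lemma cabsV z : cabs z^-1 = (cabs z)^-1.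
Proof. by apply: (@complexI R); rewrite fmorphV /= -!cabsE normfV. Qed.

Lemma cabsD z w : cabs (z + w) <= cabs z + cabs w.
Proof. by rewrite -lecR rmorphD /= -!cabsE ler_normD. Qed.

Lemma cabs_sum (I : Type) (r : seq I) (P : pred I) (f : I -> Cplx R) :
  cabs (\sum_(i <- r | P i) f i) <= \sum_(i <- r | P i) cabs (f i).
Proof.
elim/big_ind2: _ => [|x1 x2 y1 y2 h1 h2|//]; first by rewrite cabs0.
by rewrite (le_trans (cabsD _ _)) // lerD.
Qed.

Lemma cabs_real (x : R) : 0 <= x -> cabs (x%:C%C : Cplx R) = x.
Proof. by move=> x0; rewrite /cabs ger0_norm ?ler0c. Qed.

Lemma normRe_le_cabs z : `|Re (z : R[i])| <= cabs z.
Proof. by rewrite -lecR -cabsE; exact: normc_ge_Re. Qed.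

Lemma normIm_le_cabs z : `|Im (z : R[i])| <= cabs z.
Proof.
have -> : Im (z : R[i]) = - Re ((z : R[i]) * 'i%C) by rewrite ReiNIm opprK.
rewrite normrN; apply: le_trans (normRe_le_cabs _) _.
have -> : cabs ((z : R[i]) * 'i%C : Cplx R) = cabs z * cabs ('i%C : Cplx R) by exact: cabsM.
suff -> : cabs ('i%C : Cplx R) = 1 by rewrite mulr1.
by rewrite /cabs normc_def /= expr0n /= add0r expr1n sqrtr1.
Qed.

Lemma cabs_le_ReIm z : cabs z <= `|Re (z : R[i])| + `|Im (z : R[i])|.
Proof.
rewrite /cabs normc_def /= -[leRHS]ger0_norm ?addr_ge0 // -sqrtr_sqr.
rewrite ler_wsqrtr // sqrrD !real_normK ?num_real // -addrA lerD2l lerDr.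
by rewrite mulrn_wge0 // mulr_ge0.
Qed.

Lemma cabs_cvgP (u : nat -> Cplx R) (l : Cplx R) :
  u @ \oo --> l <->
  forall e : R, 0 < e -> \forall n \near \oo, cabs (l - u n) < e.
Proof.
split=> [/cvgrPdist_lt h e e0|h].
  have := h (e%:C%C : Cplx R); rewrite ltcR => /(_ e0); apply: filterS => n.
  by rewrite cabsE ltcR.
apply/cvgrPdist_lt => e e0.
have eE : e = (cabs e)%:C%C by rewrite -cabsE gtr0_norm.
have : 0 < cabs e by rewrite cabs_gt0 gt_eqF.
by move=> /h; apply: filterS => n; rewrite {2}eE cabsE ltcR.
Qed.

Lemma cvgDB (u v : nat -> Cplx R) (l m c : Cplx R) :
  u @ \oo --> l -> v @ \oo --> m ->
  (fun n => u n + v n - c : Cplx R) @ \oo --> l + m - c.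
Proof.
by move=> ul vm; apply: cvgB; [apply: cvgD; [exact: ul|exact: vm]|exact: cvg_cst].
Qed.

Lemma cvgDM (u : nat -> Cplx R) (l a c : Cplx R) :
  u @ \oo --> l -> (fun n => c + a * u n : Cplx R) @ \oo --> c + a * l.
Proof.
move=> ul.
have h : (fun n => a * u n : Cplx R) @ \oo --> a * l by exact: (cvgMr ul).
by apply: cvgD; [exact: cvg_cst|exact: h].
Qed.

(** Real and imaginary parts are absolutely convergent by comparison with [v]; their limits are
    recombined. *)
Lemma series_cvg_dominated (u : nat -> Cplx R) (v : nat -> R) :
  (forall n, cabs (u n) <= v n) -> cvgn (series v) -> cvgn (series u).
Proof.
move=> uv cv.
have v0 n : 0 <= v n by apply: le_trans (uv n); exact: cabs_ge0.
have part (p : R[i] -> R) : (forall z : Cplx R, `|p z| <= cabs z) ->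
    cvgn (series (fun n => p (u n) : R)).
  move=> pc; apply: normed_cvg; apply: series_le_cvg cv => //= n.
  exact: le_trans (uv n).
have cr := part (@Re R) normRe_le_cabs.
have ci := part (@Im R) normIm_le_cabs.
set a := limn (series (fun n => Re (u n : R[i]))) in cr.
set b := limn (series (fun n => Im (u n : R[i]))) in ci.
apply/cvg_ex; exists ((a +i* b)%C : Cplx R); apply/cabs_cvgP => e e0.
have e2 : 0 < e / 2 by rewrite divr_gt0.
have /cvgrPdist_lt/(_ _ e2) ca : series (fun n => Re (u n : R[i])) @ \oo --> a := cr.
have /cvgrPdist_lt/(_ _ e2) cb : series (fun n => Im (u n : R[i])) @ \oo --> b := ci.
near=> n.
apply: le_lt_trans (cabs_le_ReIm _) _.
rewrite [ltRHS](_ : e = e / 2 + e / 2); last by lra.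
have ReE : Re (series u n : R[i]) = series (fun n => Re (u n : R[i])) n.
  by rewrite /series /=; exact: (raddf_sum (@Re R)).
have ImE : Im (series u n : R[i]) = series (fun n => Im (u n : R[i])) n.
  by rewrite /series /=; exact: (raddf_sum (@Im R)).
apply: ltrD.
  rewrite (_ : Re _ = a - series (fun n => Re (u n : R[i])) n); first by near: n.
  by rewrite -ReE; exact: (raddfB (@Re R)).
rewrite (_ : Im _ = b - series (fun n => Im (u n : R[i])) n); first by near: n.
by rewrite -ImE; exact: (raddfB (@Im R)).
Unshelve. all: by end_near. Qed.

End ComplexModulus.

(** * Convergence of the theta series and its functional equation *)

Section Theta.
Variables (R : realType) (q : Cplx R).
Hypothesis hq : 1 < `|q|.
Implicit Types (z : Cplx R).

Let q1 : 1 < cabs q. Proof. by rewrite -ltcR -cabsE. Qed.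

Let q0 : q != 0. Proof. by rewrite -cabs_gt0 (lt_trans _ q1). Qed.

(** The terms of the Laurent series with nonnegative index. Those of negative index have the same
    shape at [(q * z)^-1], so theta splits into two partial theta functions. *)
Definition ptheta_term z n : Cplx R := (-1) ^+ n * q ^- (n * n.-1)./2 * z ^+ n.

Definition ptheta z : Cplx R := limn (series (ptheta_term z)).

Lemma cabs_ptheta_term z n :
  cabs (ptheta_term z n) = cabs z ^+ n * cabs q ^- (n * n.-1)./2.
Proof.
by rewrite /ptheta_term !cabsM cabsV !cabsX cabsN cabs1 expr1n mul1r mulrC.
Qed.

Lemma half_mul_succ n : (n.+1 * n)./2 = ((n * n.-1)./2 + n)%N.
Proof.
case: n => // n; rewrite -[n.+1.-1]/n.
have -> : (n.+2 * n.+1 = n.+1 * n + n.+1.*2)%N.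
  by rewrite -muln2 -mulnDr mulnC addn2.
by rewrite halfD oddM /= odd_double andbF doubleK.
Qed.

Lemma ptheta_termS z n : ptheta_term (q * z) n.+1 = - (q * z) * ptheta_term z n.
Proof.
rewrite /ptheta_term half_mul_succ /= exprD invfM exprMn !exprS.
have := expf_neq0 n q0; move: (q ^+ n) (q ^+ _)^-1 => a b a0.
by field.
Qed.

Lemma ptheta_term_inv z m : ptheta_term (q * z)^-1 m =
  (-1) ^+ m * q ^- (m * m.+1)./2 * z ^- m.
Proof.
rewrite /ptheta_term exprVn exprMn invfM [(m * m.+1)%N]mulnC half_mul_succ.
by rewrite exprD invfM; ring.
Qed.

(** Beyond the threshold [K] of [gauss_absorbs] the terms are below [8^-1 ^+ n]; the finitely many
    earlier ones are absorbed into [A]. *)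
Lemma gauss_geometric (C : R) : 0 <= C ->
  exists A, forall n, C ^+ n * cabs q ^- (n * n.-1)./2 <= A * 2^-1 ^+ n.
Proof.
move=> C0; have [K K0 h] := gauss_absorbs q1 C0 (lexx 1).
pose f n := C ^+ n * cabs q ^- (n * n.-1)./2.
have f0 n : 0 <= f n by rewrite mulr_ge0 ?invr_ge0 ?exprn_ge0 ?cabs_ge0.
exists (1 + \sum_(i < K.+1) f i * 2 ^+ i) => n; rewrite -/(f n).
have s0 : 0 <= \sum_(i < K.+1) f i * 2 ^+ i.
  by apply: sumr_ge0 => i _; rewrite mulr_ge0 // exprn_ge0.
have [nK|Kn] := leqP n K.
  rewrite exprVn ler_pdivlMr ?exprn_gt0 // (bigD1 (Ordinal (nK : (n < K.+1)%N))) //=.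
  rewrite addrCA lerDl addr_ge0 //.
  by apply: sumr_ge0 => i _; rewrite mulr_ge0 // exprn_ge0.
apply: (@le_trans _ _ (8^-1 ^+ n)).
  apply: le_trans (h n Kn); rewrite -/(f n) mul1r ler_peMl //.
  by rewrite -exprM exprn_ege1 // ler1n.
apply: (@le_trans _ _ (2^-1 ^+ n)).
  by rewrite lerXn2r // ?nnegrE ?invr_ge0 // lef_pV2 ?posrE // ler_nat.
by rewrite ler_peMl ?exprn_ge0 ?invr_ge0 // lerDl.
Qed.

Lemma ptheta_cvg z : series (ptheta_term z) @ \oo --> ptheta z.
Proof.
have [A hA] := gauss_geometric (cabs_ge0 z).
apply: (@series_cvg_dominated _ _ (geometric A 2^-1)).
  by move=> n; rewrite cabs_ptheta_term; exact: hA.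
by apply: is_cvg_geometric_series; rewrite ger0_norm ?invr_ge0 // invf_lt1 // ltr1n.
Qed.

(** The [- 1] compensates for the constant term, which both halves contain. *)
Lemma theta_partialE z N : (0 < N)%N ->
  theta_partial q z N =
  series (ptheta_term z) N + series (ptheta_term (q * z)^-1) N - 1.
Proof.
move=> N0; rewrite /theta_partial /series /= -addrA; congr (_ + _).
rewrite [in RHS](big_ltn N0) /ptheta_term !expr0 /= invr1 !mulr1 addrAC subrr add0r.
by apply: eq_bigr => m _; rewrite -ptheta_term_inv.
Qed.

Lemma theta_partial_cvg_ptheta z :
  theta_partial q z @ \oo --> ptheta z + ptheta (q * z)^-1 - 1.
Proof.
apply: (@cvg_trans _ ((fun N => series (ptheta_term z) N +
  series (ptheta_term (q * z)^-1) N - 1 : Cplx R) @ \oo)).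
  apply: near_eq_cvg; near=> N; rewrite theta_partialE //.
  by near: N; exists 1%N.
exact: (@cvgDB R _ _ _ _ 1 (@ptheta_cvg z) (@ptheta_cvg (q * z)^-1)).
Unshelve. all: by end_near. Qed.

Lemma theta_partial_cvg z : theta_partial q z @ \oo --> - theta q z.
Proof.
rewrite /theta opprK (cvg_lim _ (@theta_partial_cvg_ptheta z)) //;
  exact: theta_partial_cvg_ptheta.
Qed.

Lemma thetaE z : theta q z = 1 - ptheta z - ptheta (q * z)^-1.
Proof.
by rewrite /theta (cvg_lim _ (@theta_partial_cvg_ptheta z)) // opprB opprD addrA.
Qed.

Lemma ptheta_shift z : ptheta (q * z) = 1 - q * z * ptheta z.
Proof.
have -> : 1 - q * z * ptheta z = 1 + - (q * z) * ptheta z by rewrite mulNr.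
apply: cvg_lim => //; rewrite -cvg_shiftS.
have -> : (fun n => series (ptheta_term (q * z)) n.+1) =
    (fun n => 1 + - (q * z) * series (ptheta_term z) n : Cplx R).
  apply/funext => n; rewrite /series /= big_nat_recl // mulr_sumr.
  congr (_ + _); first by rewrite /ptheta_term !expr0 /= invr1 !mulr1.
  by apply: eq_bigr => i _; rewrite ptheta_termS.
exact: (@cvgDM R _ _ (- (q * z)) 1 (@ptheta_cvg z)).
Qed.

Lemma theta_shift z : z != 0 -> theta q (q * z) = - (q * z) * theta q z.
Proof.
move=> z0; rewrite !thetaE ptheta_shift.
(* The second half is handled by [ptheta_shift] at [(q * (q * z))^-1], whose [q]-multiple is
   [(q * z)^-1]. *)
have : ptheta (q * (q * (q * z))^-1) = ptheta (q * z)^-1.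
  by congr ptheta; rewrite invfM mulrA divff // mul1r.
rewrite ptheta_shift => <-; move: (ptheta _) (ptheta _) => a b.
by field; rewrite z0 q0.
Qed.

Lemma theta_iter z n : z != 0 ->
  theta q (q ^+ n * z) = (-1) ^+ n * q ^+ (n.+1 * n)./2 * z ^+ n * theta q z.
Proof.
move=> z0; elim: n => [|n IH]; first by rewrite !expr0 !mul1r.
have -> : q ^+ n.+1 * z = q * (q ^+ n * z) by rewrite exprS mulrA.
have z0' : q ^+ n * z != 0 by rewrite mulf_neq0 // expf_neq0.
rewrite (theta_shift z0') IH.
rewrite (half_mul_succ n.+1) -[n.+1.-1]/n exprD !exprS.
by move: (theta q z) (q ^+ n) (q ^+ _) => a b c; ring.
Qed.

End Theta.

(** * Polynomials that isolate the constant Laurent coefficient *)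

Section Interpolation.
Variable R : realType.

(* [interp K x] takes the value [1] at [1] and vanishes at [x^m] for
   [0 < |m| <= K]. *)
Definition interp (K : nat) (x : R) : {poly R} :=
  \prod_(1 <= m < K.+1)
    (- (x ^+ m - 1) ^- 2 *: (('X - (x ^+ m)%:P) * ((x ^+ m)%:P * 'X - 1))).

Lemma horner_interp K (x y : R) : (interp K x).[y] =
  \prod_(1 <= m < K.+1)
    (- (x ^+ m - 1) ^- 2 * ((y - x ^+ m) * (x ^+ m * y - 1))).
Proof. by rewrite horner_prod; apply: eq_bigr => m _; rewrite !hornerE. Qed.

Lemma size_interp K x : (size (interp K x) <= K.*2.+1)%N.
Proof.
rewrite /interp; elim: K => [|K IH]; first by rewrite big_geq // size_poly1.
rewrite big_nat_recr //=.
apply: leq_trans (size_polyMleq _ _) _.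
have h : (size (- (x ^+ K.+1 - 1) ^- 2 *: (('X - (x ^+ K.+1)%:P) *
    ((x ^+ K.+1)%:P * 'X - 1)) : {poly R})%R <= 3)%N.
  apply: leq_trans (size_scale_leq _ _) _.
  apply: leq_trans (size_polyMleq _ _) _.
  have : (size ((x ^+ K.+1)%:P * 'X - 1 : {poly R})%R <= 2)%N.
    by rewrite -polyCN size_MXaddC; case: ifP => // _; rewrite ltnS size_polyC; case: eqP.
  by rewrite size_XsubC; lia.
apply: (@leq_trans (K.*2.+1 + 3).-1); last by rewrite doubleS; lia.
by rewrite -!subn1 leq_sub2r // leq_add.
Qed.

Lemma horner_interp1 K x : 1 < x -> (interp K x).[1] = 1.
Proof.
move=> x1; rewrite horner_interp big_nat big1 // => m /andP[m0 _].
have : x ^+ m - 1 != 0 by rewrite subr_eq0 gt_eqF // exprn_egt1 // -lt0n.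
by move=> h; rewrite mulr1; field.
Qed.

Lemma horner_interp_root K x n : 1 < x -> (0 < n <= K)%N ->
  (interp K x).[x ^+ n] = 0 /\ (interp K x).[x ^- n] = 0.
Proof.
move=> x1 /andP[n0 nK]; rewrite !horner_interp.
have h : n \in index_iota 1 K.+1 by rewrite mem_index_iota n0.
have xn : x ^+ n != 0 by rewrite expf_neq0 // gt_eqF // (lt_trans _ x1).
split; apply/eqP; rewrite (bigD1_seq n) ?iota_uniq //=.
  by rewrite subrr mul0r mulr0 mul0r.
by rewrite divff // subrr !mulr0 mul0r.
Qed.

(** Each of the [K] factors is a normalising constant of size at most [(K / e) ^ 2], because
    [x ^ m - 1 >= e / K], times a product bounded by [4 B]. Here [B = x ^ (2 n)] at [x ^ n] and
    [B = 1] at [x ^ - n]; since [x ^ (2 K) <= 2], both satisfy [B ^ K <= 2 ^ n]. *)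
Lemma horner_interp_bound K x n (e : R) : 0 < e -> e / K%:R <= x - 1 ->
  1 < x -> x ^+ K.*2 <= 2 -> (0 < K < n)%N ->
  `|(interp K x).[x ^+ n]| <= (4 / e ^+ 2 * K%:R ^+ 2) ^+ K * 2 ^+ n /\
  `|(interp K x).[x ^- n]| <= (4 / e ^+ 2 * K%:R ^+ 2) ^+ K * 2 ^+ n.
Proof.
move=> e0 ex x1 xK /andP[K0 Kn].
have K0' : 0 < K%:R :> R by rewrite ltr0n.
have x0 : 0 < x by lra.
have factor (y B : R) : 0 <= B ->
    (forall m, (0 < m <= K)%N -> `|(y - x ^+ m) * (x ^+ m * y - 1)| <= 4 * B) ->
    `|(interp K x).[y]| <= (4 / e ^+ 2 * K%:R ^+ 2) ^+ K * B ^+ K.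
  move=> B0 h; rewrite horner_interp normr_prod -exprMn.
  rewrite -[leRHS](_ : \prod_(1 <= m < K.+1) (4 / e ^+ 2 * K%:R ^+ 2 * B) = _); last first.
    by rewrite prodr_const_nat subSS subn0.
  rewrite big_nat [leRHS]big_nat; apply: ler_prod => m /andP[m0 mK].
  rewrite normr_ge0 /= normrM.
  have xm : e / K%:R <= x ^+ m - 1.
    by rewrite (le_trans ex) // lerB // -[leLHS]expr1 ler_weXn2l // ltW.
  have eK : 0 < e / K%:R by rewrite divr_gt0.
  apply: (@le_trans _ _ ((e / K%:R) ^- 2 * (4 * B))); last first.
    by rewrite le_eqVlt; apply/orP; left; apply/eqP; field; rewrite !gt_eqF.
  rewrite ler_pM //; last by apply: h; rewrite m0 -ltnS.
  rewrite normrN ger0_norm ?invr_ge0 ?sqr_ge0 // lef_pV2 ?posrE ?exprn_gt0 //; last by lra.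
  by rewrite lerXn2r // nnegrE ?ltW //; lra.
have x2 m : (m <= K)%N -> 1 <= x ^+ m <= 2.
  move=> mK; rewrite exprn_ege1 ?(ltW x1) //= (le_trans _ xK) //.
  by rewrite ler_weXn2l ?(ltW x1) //; lia.
have two n' : 1 <= 2 ^+ n' :> R by rewrite exprn_ege1 // ler1n.
have L0 : 0 <= (4 / e ^+ 2 * K%:R ^+ 2) ^+ K.
  by rewrite exprn_ge0 // mulr_ge0 ?sqr_ge0 // divr_ge0 // sqr_ge0.
split.
  apply: (@le_trans _ _ ((4 / e ^+ 2 * K%:R ^+ 2) ^+ K * ((x ^+ n) ^+ 2) ^+ K)).
    apply: factor; first exact: sqr_ge0.
    move=> m /andP[m0 mK]; have /andP[xm1 xm2] := x2 m mK.
    have xmn : x ^+ m <= x ^+ n by rewrite ler_weXn2l ?(ltW x1) //; lia.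
    rewrite ger0_norm; last by rewrite mulr_ge0 // subr_ge0 // -[leLHS]mulr1 ler_pM //; lra.
    by move: xm1 xm2 xmn; move: (x ^+ m) (x ^+ n) => a b; nra.
  rewrite ler_wpM2l // -!exprM (_ : n * (2 * K) = K.*2 * n)%N; last first.
    by rewrite mul2n mulnC.
  rewrite exprM lerXn2r // nnegrE //.
  by rewrite exprn_ge0 // ltW.
apply: (@le_trans _ _ ((4 / e ^+ 2 * K%:R ^+ 2) ^+ K * 1 ^+ K)); last first.
  by rewrite expr1n ler_wpM2l.
apply: factor => // m /andP[m0 mK]; have /andP[xm1 xm2] := x2 m mK.
have xn1 : x ^- n <= 1 by rewrite invf_le1 ?exprn_gt0 // exprn_ege1 // ltW.
have xn0 : 0 <= x ^- n by rewrite invr_ge0 exprn_ge0 // ltW.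
rewrite mulr1 normrM (_ : 4 = 2 * 2); last by lra.
move: xn1 xn0 xm1 xm2; move: (x ^- n) (x ^+ m) => a b a1 a0 b1 b2.
by apply: ler_pM => //; rewrite ler_norml; apply/andP; split; nra.
Qed.

End Interpolation.

(** * Nonvanishing of theta on finite geometric progressions *)

Section ThetaNonvanishing.
Variables (R : realType) (q : Cplx R).
Hypothesis hq : 1 < `|q|.

Lemma ptheta_termM (z a : Cplx R) n :
  ptheta_term q (z * a) n = ptheta_term q z n * a ^+ n.
Proof. by rewrite /ptheta_term exprMn mulrA. Qed.

Lemma ptheta_term0 (z : Cplx R) : ptheta_term q z 0 = 1.
Proof. by rewrite /ptheta_term !expr0 /= invr1 !mulr1. Qed.

Lemma cvg_lincomb0 (u : nat -> nat -> Cplx R) (c : nat -> Cplx R) m :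
  (forall k, (k < m)%N -> u k @ \oo --> (0 : Cplx R)) ->
  (fun n => \sum_(k < m) c k * u k n : Cplx R) @ \oo --> (0 : Cplx R).
Proof.
elim: m => [|m IH] h.
  have -> : (fun n => \sum_(k < 0) c k * u k n) = cst (0 : Cplx R).
    by apply/funext => n; rewrite big_ord0.
  exact: cvg_cst.
have -> : (fun n => \sum_(k < m.+1) c k * u k n) =
    (fun n => \sum_(k < m) c k * u k n + c m * u m n).
  by apply/funext => n; rewrite big_ord_recr.
have h1 : (fun n => \sum_(k < m) c k * u k n) @ \oo --> (0 : Cplx R).
  by apply: IH => k km; apply: h; rewrite ltnS ltnW.
have h2 : (fun n => c m * u m n : Cplx R) @ \oo --> c m * 0.
  exact: (cvgMr (h m (ltnSn m))).
rewrite mulr0 in h2; rewrite -[X in _ --> X]addr0.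
by apply: cvgD; [exact: h1|exact: h2].
Qed.

Lemma sum_expr8V N : \sum_(1 <= n < N) (8^-1 : R) ^+ n <= 7^-1.
Proof.
(* The closed form is stable under induction, unlike the bound by [7^-1] alone. *)
suff: \sum_(1 <= n < N) (8^-1 : R) ^+ n <= 7^-1 * (1 - 8^-1 ^+ N.-1).
  have : 0 <= (8^-1 : R) ^+ N.-1 by rewrite exprn_ge0 // invr_ge0.
  by move: (8^-1 ^+ _) (\sum_(_ <= _ < _) _) => a b; lra.
case: N => [|N]; first by rewrite big_geq // expr0 subrr mulr0.
elim: N => [|N IH]; first by rewrite big_geq // expr0 subrr mulr0.
rewrite big_nat_recr //= (le_trans (lerD IH (lexx _))) //= exprS.
by move: (8^-1 ^+ N) => a; lra.
Qed.

Section Combination.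
Variables (P : {poly R}) (m : nat).
Hypothesis sizeP : (size P <= m)%N.

Lemma horner_complex (u : R) :
  \sum_(k < m) (P`_k)%:C%C * (u%:C%C : Cplx R) ^+ k = (P.[u])%:C%C.
Proof.
rewrite (horner_coef_wide _ sizeP) raddf_sum; apply: eq_bigr => k _.
by rewrite -rmorphXn -rmorphM.
Qed.

(** Sampling at [y x ^ k] with the coefficients of [P] as weights multiplies the term of index [n]
    by [P.[x ^+ n]], since [(x ^ k) ^ n = (x ^ n) ^ k]. *)
Lemma ptheta_lincomb (y : Cplx R) (x : R) N :
  \sum_(k < m) (P`_k)%:C%C * series (ptheta_term q (y * (x ^+ k)%:C%C)) N =
  \sum_(0 <= n < N) ptheta_term q y n * (P.[x ^+ n])%:C%C.
Proof.
under eq_bigr => k _.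
  rewrite /series /= mulr_sumr.
  over.
rewrite exchange_big /=; apply: eq_bigr => n _.
rewrite -horner_complex mulr_sumr; apply: eq_bigr => k _.
rewrite ptheta_termM mulrCA; congr (_ * (_ * _)).
by rewrite -!rmorphXn /= -!exprM mulnC.
Qed.

Lemma theta_partial_lincomb (y : Cplx R) (x : R) N : (0 < N)%N ->
  \sum_(k < m) (P`_k)%:C%C * theta_partial q (y * (x ^+ k)%:C%C) N =
  (P.[1])%:C%C + \sum_(1 <= n < N)
    (ptheta_term q y n * (P.[x ^+ n])%:C%C +
     ptheta_term q (q * y)^-1 n * (P.[x ^- n])%:C%C).
Proof.
move=> N0.
(* The constant term occurs once in each half and once in the correction [- 1], so its net weight is
   [P.[1]]. *)
have -> : \sum_(k < m) (P`_k)%:C%C * theta_partial q (y * (x ^+ k)%:C%C) N =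
    \sum_(k < m) (P`_k)%:C%C * series (ptheta_term q (y * (x ^+ k)%:C%C)) N +
    \sum_(k < m) (P`_k)%:C%C *
      series (ptheta_term q ((q * y)^-1 * (x^-1 ^+ k)%:C%C)) N -
    \sum_(k < m) (P`_k)%:C%C * (1%:C%C : Cplx R) ^+ k.
  rewrite -big_split /= -sumrB; apply: eq_bigr => k _.
  rewrite (theta_partialE _ _ N0) mulrDr mulrDr mulrN1 expr1n mulr1.
  by rewrite exprVn fmorphV /= mulrA -invfM.
rewrite !ptheta_lincomb horner_complex !(big_ltn N0) !ptheta_term0 !expr0 !mul1r.
rewrite big_split /=.
under [X in _ + (_ + X) - _]eq_bigr do rewrite exprVn.
by rewrite addrACA -[RHS]addr0 -(subrr (P.[1])%:C%C); ring.
Qed.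

End Combination.

(* The finite combination of the values [theta q (w s x^k)] with the coefficients
   of [interp K x] cancels the Laurent coefficients of index [0 < |n| <= K] and
   keeps the constant one, while the tail is smaller than one half. *)
Lemma theta_nonvanishing (w : Cplx R) (delta : R) : w != 0 -> 0 < delta <= 1 ->
  exists (K : nat) (x : R), [/\ 1 < x, x ^+ K.*2 <= 1 + delta &
    forall s : R, 1 <= s <= 2 ->
      exists2 k : nat, (k <= K.*2)%N & theta q (w * (s * x ^+ k)%:C%C) != 0].
Proof.
move=> w0 /andP[d0 d1].
have q1 : 1 < cabs q by rewrite -ltcR -cabsE.
have q0 : q != 0 by rewrite -cabs_gt0 (lt_trans _ q1).
(* This gives [2 K * (e / K) = delta / 2], hence [x ^ (2 K) <= 1 / (1 - delta / 2) <= 1 + delta]. *)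
pose e := delta / 4.
have e0 : 0 < e by rewrite /e; lra.
have e4 : e <= 4^-1 by rewrite /e; lra.
(* [C] bounds [2 |y|] and [2 |(q y)^-1|] for [y = w s] with [1 <= s <= 2]; the factor 2 makes room
   for the [2 ^ n] of [horner_interp_bound]. *)
pose C := 4 * cabs w + 2 * (cabs (q * w))^-1.
have c1 := cabs_ge0 w; have c2 : 0 <= (cabs (q * w))^-1 by rewrite invr_ge0 cabs_ge0.
have C0 : 0 <= C by rewrite /C; lra.
have M1 : 1 <= 4 / e ^+ 2.
  by rewrite ler_pdivlMr ?exprn_gt0 // mul1r; nra.
have [K K0 HK] := gauss_absorbs q1 C0 M1.
have K0' : 0 < K%:R :> R by rewrite ltr0n.
pose x := 1 + e / K%:R.
have eK : 0 < e / K%:R by rewrite divr_gt0.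
have x1 : 1 < x by rewrite /x; lra.
have xK : x ^+ K.*2 <= 1 + delta.
  have := exprn1D_upper K.*2 (ltW eK).
  have -> : K.*2%:R * (e / K%:R) = delta / 2.
    by rewrite -muln2 natrM /e; field; rewrite gt_eqF.
  rewrite -/x; have : 0 <= x ^+ K.*2 by rewrite exprn_ge0 // ltW // (lt_trans _ x1).
  by move: (x ^+ _) => X; nra.
exists K, x; split => // s /andP[s1 s2].
apply: contrapT => none.
have zero k : (k < K.*2.+1)%N -> theta q (w * s%:C%C * (x ^+ k)%:C%C) = 0.
  move=> kK; apply/eqP; apply: contraT => h; exfalso; apply: none.
  have e1 : w * (s * x ^+ k)%:C%C = w * s%:C%C * (x ^+ k)%:C%C :> Cplx R.
    by rewrite rmorphM mulrA.
  by exists k; [exact: kK|rewrite e1; exact: h].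
pose y : Cplx R := w * s%:C%C.
pose Q := interp K x.
pose E N : Cplx R :=
  \sum_(k < K.*2.+1) (Q`_k)%:C%C * theta_partial q (y * (x ^+ k)%:C%C) N.
have E0 : E @ \oo --> (0 : Cplx R).
  apply: (@cvg_lincomb0 (fun k => theta_partial q (y * (x ^+ k)%:C%C))
    (fun k => (Q`_k)%:C%C)) => k kK.
  have h := @theta_partial_cvg _ _ hq (w * s%:C%C * (x ^+ k)%:C%C).
  rewrite (zero _ kK) oppr0 in h; exact: h.
have /cabs_cvgP/(_ 2^-1) := E0.
rewrite invr_gt0 => /(_ ltac:(by [])) [N _ /(_ N.+1 (leqnSn N))] /=.
apply/negP; rewrite -leNgt sub0r cabsN.
have tail n : (0 < n)%N ->
    cabs (ptheta_term q y n * (Q.[x ^+ n])%:C%C +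
     ptheta_term q (q * y)^-1 n * (Q.[x ^- n])%:C%C) <= 2 * 8^-1 ^+ n.
  move=> n0; have [nK|Kn] := leqP n K.
    have [|-> ->] := @horner_interp_root _ K x n x1; first by rewrite n0.
    by rewrite !mulr0 addr0 cabs0 mulr_ge0 ?exprn_ge0 ?invr_ge0.
  have [|||b1 b2] := @horner_interp_bound _ K x n e e0 _ x1 _ _.
  - by rewrite /x addrAC subrr add0r.
  - by rewrite (le_trans xK) //; lra.
  - by rewrite K0.
  have half (z : Cplx R) (b : R) : 2 * cabs z <= C ->
     `|b| <= (4 / e ^+ 2 * K%:R ^+ 2) ^+ K * 2 ^+ n ->
     cabs (ptheta_term q z n * b%:C%C) <= 8^-1 ^+ n.
    move=> zC bL; apply: le_trans (HK n Kn).
    rewrite cabsM cabs_ptheta_term.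
    have -> : cabs (b%:C%C : Cplx R) = `|b| by rewrite /cabs normc_def /= expr0n addr0 sqrtr_sqr.
    apply: (@le_trans _ _ (cabs z ^+ n * cabs q ^- (n * n.-1)./2 *
      ((4 / e ^+ 2 * K%:R ^+ 2) ^+ K * 2 ^+ n))).
      by rewrite ler_wpM2l // mulr_ge0 ?invr_ge0 ?exprn_ge0 ?cabs_ge0.
    rewrite mulrCA ler_wpM2l ?exprn_ge0 ?mulr_ge0 ?sqr_ge0 //; first by lra.
    rewrite mulrAC -exprMn ler_wpM2r ?invr_ge0 ?exprn_ge0 ?cabs_ge0 //.
    rewrite lerXn2r ?nnegrE ?mulr_ge0 ?cabs_ge0 //.
    by rewrite mulrC.
  apply: le_trans (cabsD _ _) _; rewrite mulr_natl mulr2n lerD //.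
    apply: half b1; rewrite /y cabsM cabs_real; last by lra.
    by rewrite /C; nra.
  apply: half b2; rewrite /y mulrA cabsV cabsM cabs_real; last by lra.
  rewrite invfM /C.
  have : s^-1 <= 1 by rewrite invf_le1 //; lra.
  have : 0 <= s^-1 by rewrite invr_ge0; lra.
  by move: (s^-1) => s'; nra.
(* The main term is 1 and the tail is at most [2 / 7], so [E] stays at least [5 / 7] in modulus
   although it tends to 0. *)
rewrite /E (theta_partial_lincomb (size_interp K x)) // horner_interp1 //.
set T := \sum_(1 <= n < N.+1) _.
have T1 : cabs T <= 2 * 7^-1.
  apply: le_trans (cabs_sum _ _ _) _.
  apply: le_trans (_ : \sum_(1 <= n < N.+1) 2 * 8^-1 ^+ n <= _).
    by rewrite big_nat [leRHS]big_nat; apply: ler_sum => n /andP[n0 _]; exact: tail.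
  by rewrite -mulr_sumr ler_wpM2l // sum_expr8V.
have : cabs (1 : Cplx R) <= cabs (1%:C%C + T) + cabs T.
  rewrite -[cabs T]cabsN; apply: le_trans (cabsD _ _); rewrite addrK.
  by rewrite lexx.
by rewrite cabs1; lra.
Qed.

End ThetaNonvanishing.

(** * Discrete sets and generic real multiples *)

Section Discrete.
Variable R : realType.
Implicit Types (z w : Cplx R) (S T : set (Cplx R)).

Lemma discreteP S w : discrete_in_Cstar S -> w != 0 ->
  exists2 r : R, 0 < r & forall s, S s -> cabs (s - w) < r -> s = w.
Proof.
move=> [_ /(_ w)] h /h[r r0 rP]; exists (cabs r).
  by rewrite cabs_gt0 gt_eqF.
move=> s Ss sw; apply: rP => //; rewrite cabsE.
by rewrite -(gtr0_norm r0) cabsE ltcR.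
Qed.

Lemma discrete0 : discrete_in_Cstar (set0 : set (Cplx R)).
Proof. by split=> [//|w _]; exists 1. Qed.

Lemma discreteU S T : discrete_in_Cstar S -> discrete_in_Cstar T ->
  discrete_in_Cstar (S `|` T).
Proof.
move=> dS dT; split=> [z [/dS.1|/dT.1] //|w w0].
have [r r0 rP] := discreteP dS w0; have [r' r'0 r'P] := discreteP dT w0.
exists ((Num.min r r')%:C%C : Cplx R); first by rewrite ltcR lt_min r0.
move=> s; rewrite cabsE ltcR lt_min => -[Ss|Ts] /andP[h h'].
  exact: rP.
exact: r'P.
Qed.

Lemma discrete_bigcup (S : nat -> set (Cplx R)) n :
  (forall i, (i < n)%N -> discrete_in_Cstar (S i)) ->
  discrete_in_Cstar [set z | exists2 i, (i < n)%N & S i z].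
Proof.
elim: n => [|n IH] h.
  rewrite (_ : [set z | _] = set0); first exact: discrete0.
  by apply/seteqP; split => z //= [].
rewrite (_ : [set z | _] = [set z | exists2 i, (i < n)%N & S i z] `|` S n).
  apply: discreteU; last exact: h.
  by apply: IH => i lin; apply: h; rewrite ltnS ltnW.
apply/seteqP; split => z /= [].
- by move=> i; rewrite ltnS leq_eqVlt => /orP[/eqP->|lin] Sz; [right|left; exists i].
- by move=> [i lin Sz]; exists i => //; rewrite ltnS ltnW.
- by move=> Sz; exists n.
Qed.

Lemma cabs_realM (c : Cplx R) (s s' : R) :
  cabs (c * s%:C%C - c * s'%:C%C) = cabs c * `|s - s'|.
Proof.
rewrite -mulrBr cabsM -rmorphB; congr (_ * _).
by rewrite /cabs normc_def /= expr0n addr0 sqrtr_sqr.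
Qed.

(** Baire's theorem for countably many open dense conditions on [s], one for each ray through [c i]:
    the points of [T] on a ray are isolated. *)
Lemma generic_real (T : set (Cplx R)) (c : nat -> Cplx R) (a b : R) :
  discrete_in_Cstar T -> (forall i, c i != 0) -> 1 <= a -> a < b ->
  exists2 s : R, a < s < b & forall i, ~ T (c i * s%:C%C).
Proof.
move=> dT c0 a1 ab.
(* Points of [T] may accumulate at 0; admitting every [s < 1] keeps [F i] open there, and is
   harmless since [1 <= a]. *)
pose F i := [set s : R | s < 1 \/ ~ T (c i * s%:C%C)].
have cpos i : 0 < cabs (c i) by rewrite cabs_gt0.
have FP i : open (F i) /\ dense (F i).
  split.
    rewrite openE => s Fs; rewrite /interior.
    have [s1|s1] := ltrP s 1.
      apply/nbhs_ballP; exists (1 - s); first by rewrite /= subr_gt0.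
      move=> u; rewrite /ball /= => su; left.
      by move: su; rewrite distrC ltr_norml => /andP[_]; lra.
    have Ts : ~ T (c i * s%:C%C) by case: Fs => // ; lra.
    have cs0 : c i * s%:C%C != 0.
      by rewrite mulf_neq0 // -cabs_gt0 cabs_real; lra.
    have [r r0 rP] := discreteP dT cs0.
    apply/nbhs_ballP; exists (r / cabs (c i)); first by rewrite /= divr_gt0.
    move=> u; rewrite /ball /= => su; right => Tu.
    apply: Ts; rewrite -(rP _ Tu) //.
    by rewrite cabs_realM mulrC -ltr_pdivlMr // distrC.
  move=> O [s Os] oO.
  have [s1|s1] := ltrP s 1; first by exists s; split => //; left.
  have [Ts|Ts] := pselect (T (c i * s%:C%C)); last by exists s; split => //; right.
  have [r r0 rP] := discreteP dT (dT.1 _ Ts).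
  have /nbhs_ballP[e e0 eP] : nbhs s O by exact: open_nbhs_nbhs.
  rewrite /= in e0.
  pose h := Num.min (e / 2) (r / cabs (c i) / 2).
  have rc : 0 < r / cabs (c i) by rewrite divr_gt0.
  have h0 : 0 < h by rewrite lt_min; apply/andP; split; lra.
  have he : h <= e / 2 by rewrite ge_min lexx.
  have hr : h <= r / cabs (c i) / 2 by rewrite ge_min lexx orbT.
  exists (s + h); split.
    by apply: eP; rewrite /ball /= opprD addrA subrr sub0r normrN gtr0_norm //; lra.
  right => Tsh.
  have : c i * (s + h)%:C%C = c i * s%:C%C.
    apply: (rP _ Tsh); rewrite cabs_realM addrAC subrr add0r gtr0_norm //.
    by rewrite mulrC -ltr_pdivlMr //; lra.
  by move/(mulfI (c0 i))/complexI; lra.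
have := Baire FP.
move=> /(_ `]a, b[%classic) [||s [sab sF]].
- by exists ((a + b) / 2); rewrite /= in_itv /=; apply/andP; split; lra.
- exact: interval_open.
move: sab; rewrite /= in_itv /= => sab.
exists s => // i; have [s1|//] := sF i I.
by move: sab => /andP[]; lra.
Qed.

End Discrete.

(** * The relation along an orbit of multiplication by q *)

Section OrbitRational.
Variables (R : realType) (q z : Cplx R).
Hypotheses (hq : 1 < `|q|) (z0 : z != 0).

Let q1 : 1 < cabs q. Proof. by rewrite -ltcR -cabsE. Qed.

Let q0 : q != 0. Proof. by rewrite -cabs_gt0 (lt_trans _ q1). Qed.

Let X n : Cplx R := q ^+ n * z.

Let w n : Cplx R := (-1) ^+ n * q ^+ (n.+1 * n)./2 * z ^+ n.

Lemma orbit_unbounded (M : Cplx R) : 0 <= M -> \forall n \near \oo, M <= `|X n|.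
Proof.
move=> M0; have zc : 0 < cabs z by rewrite cabs_gt0.
have [N HN] := natr_unbounded (cabs M / cabs z / (cabs q - 1)).
exists N => // n /= Nn.
rewrite -(ger0_norm M0) !cabsE lecR /X cabsM cabsX -ler_pdivrMr //.
have h : 0 < cabs q - 1 by rewrite subr_gt0.
apply: (@le_trans _ _ (1 + n%:R * (cabs q - 1))).
  rewrite ler_pdivrMr // in HN.
  have : N%:R * (cabs q - 1) <= n%:R * (cabs q - 1).
    by rewrite ler_wpM2r ?(ltW h) // ler_nat.
  by lra.
have := bernoulli_le n (ltW h).
by rewrite [1 + (_ - 1)]addrC subrK.
Qed.

(** The quotient [|X n| ^ k / |w n|] is [|z| ^ k C ^ n |q| ^ (- n (n - 1) / 2)] with
    [C = |q| ^ k / (|z| |q|)]; [gauss_geometric] leaves a factor [2 ^ - n] that absorbs all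
    constants. *)
Lemma orbit_superexp (M : Cplx R) k : 0 <= M ->
  \forall n \near \oo, M * `|X n| ^+ k <= `|w n|.
Proof.
move=> M0; have zc : 0 < cabs z by rewrite cabs_gt0.
have qc : 0 < cabs q by rewrite (lt_trans _ q1).
have C0 : 0 <= cabs q ^+ k / cabs z / cabs q.
  by rewrite !divr_ge0 ?exprn_ge0 ?cabs_ge0.
have [A hA] := gauss_geometric hq C0.
have [N HN] := natr_unbounded (cabs M * cabs z ^+ k * A).
exists N => // n /= Nn.
rewrite -(ger0_norm M0) -normrX -normrM !cabsE lecR /X /w.
rewrite !(cabsM, cabsX, cabsN) cabs1 expr1n mul1r half_mul_succ exprD.
set G := (n * n.-1)./2.
have qG : 0 < cabs q ^+ G by rewrite exprn_gt0.
have qn : 0 < cabs q ^+ n by rewrite exprn_gt0.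
have zn : 0 < cabs z ^+ n by rewrite exprn_gt0.
have h : (cabs q ^+ n) ^+ k <=
    A * 2^-1 ^+ n * cabs q ^+ G * cabs q ^+ n * cabs z ^+ n.
  have := hA n; rewrite -/G ler_pdivrMr // !exprMn !exprVn.
  by rewrite ler_pdivrMr // ler_pdivrMr // -!exprM mulnC.
have MZ : 0 <= cabs M * cabs z ^+ k by rewrite mulr_ge0 ?exprn_ge0 ?cabs_ge0.
rewrite exprMn mulrCA mulrC.
apply: (le_trans (ler_wpM2l MZ h)).
have n2 : n%:R <= 2 ^+ n :> R.
  have := @bernoulli_le R 1 n ler01; rewrite mulr1 -[1 + 1]/(2 : R).
  by move: (2 ^+ n) => a; lra.
have AN : cabs M * cabs z ^+ k * A * 2^-1 ^+ n <= 1.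
  rewrite exprVn ler_pdivrMr ?exprn_gt0 // mul1r (le_trans HN) // (le_trans _ n2) //.
  by rewrite ler_nat.
rewrite -[leRHS]mul1r.
apply: (le_trans _ (ler_wpM2r _ AN)); last by rewrite !mulr_ge0 // ltW.
by rewrite le_eqVlt; apply/orP; left; apply/eqP; ring.
Qed.

(** Unlike in [rat_seq], equality holds for every [n], in particular at [n = 0], where the orbit
    starts at [z]. For [B = 0] the sequence is 0, as division by 0 yields 0. *)
Definition orbit_rational (u : nat -> Cplx R) := exists A B : {poly Cplx R},
  forall n, u n = A.[X n] / B.[X n].

Lemma orbit_rational_seq u : orbit_rational u -> rat_seq X u.
Proof.
move=> [A [B uP]]; have [B0|B0] := eqVneq B 0.
  have -> : u = fun=> 0 by apply/funext => n; rewrite uP B0 horner0 invr0 mulr0.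
  exact: rat_seq0.
by exists A, B; split => //; near=> n.
Unshelve. all: by end_near. Qed.

(** For [B != 0], the numerator vanishes at arbitrarily late orbit points, hence identically. This
    carries vanishing from large [n] back to [z] itself. *)
Lemma orbit_rational_eq0 u : orbit_rational u ->
  (\forall n \near \oo, u n = 0) -> u 0%N = 0.
Proof.
move=> [A [B uP]] u0; rewrite uP; have [->|B0] := eqVneq B 0.
  by rewrite horner0 invr0 mulr0.
have [c c0 [N1 _ N1P]] := horner_lower_bound orbit_unbounded B0.
case: u0 => N2 _ N2P.
suff -> : A = 0 by rewrite horner0 mul0r.
apply: (horner_freq0 orbit_unbounded) => N.
exists (maxn N (maxn N1 N2)); first by rewrite leq_maxl.
have h1 : (N1 <= maxn N (maxn N1 N2))%N by rewrite !leq_max leqnn orbT.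
have h2 : (N2 <= maxn N (maxn N1 N2))%N by rewrite !leq_max leqnn !orbT.
have /= := N2P _ h2; rewrite uP => /eqP; rewrite mulf_eq0 invr_eq0.
case/orP => [/eqP//|/eqP e]; have /= := N1P _ h1.
by rewrite e normr0 lt_geF.
Qed.

Lemma near_forall_lt (Q : nat -> nat -> Prop) m :
  (forall r, (r < m)%N -> \forall n \near \oo, Q r n) ->
  \forall n \near \oo, forall r, (r < m)%N -> Q r n.
Proof.
elim: m => [|m IH] h; first by near=> n.
have h1 : \forall n \near \oo, forall r, (r < m)%N -> Q r n.
  by apply: IH => r rm; apply: h; rewrite ltnS ltnW.
have h2 := h m (ltnSn m).
near=> n => r; rewrite ltnS leq_eqVlt => /orP[/eqP->|]; first by near: n.
by move: r; near: n.
Unshelve. all: by end_near. Qed.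

Variables (t : nat) (zeta : Cplx R) (l0 : nat -> Cplx R)
  (l : nat -> nat -> nat -> Cplx R).
Hypotheses (pt : prime t) (hzeta : t.-primitive_root zeta).
Hypothesis l0rat : orbit_rational l0.
Hypothesis lrat : forall j d, (j < t)%N -> (1 <= d < t)%N -> orbit_rational (l j d).
Hypothesis rel : forall n, l0 n + \sum_(1 <= d < t) \sum_(j < t)
  l j d n * theta q (zeta ^+ j * X n) ^+ d = 0.

(* On the residue class [n = r mod t] the relation along the orbit is polynomial
   in [w n] with coefficients [v r d n]. *)
Lemma orbit_residue_vanishing r d : (r < t)%N -> (d < t)%N ->
  \forall n \near \oo, (if d == 0%N then l0 n else
    \sum_(j < t) zeta ^+ (j * r * d) * (theta q (zeta ^+ j * z) ^+ d * l j d n)) = 0.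
Proof.
move=> rt; have t0 := prime_gt0 pt.
pose v d n := if d == 0%N then l0 n else
  \sum_(j < t) zeta ^+ (j * r * d) * (theta q (zeta ^+ j * z) ^+ d * l j d n).
have zeta0 : zeta != 0.
  by apply/eqP => e; have /eqP := prim_expr_order hzeta; rewrite e expr0n gtn_eqF // eq_sym oner_eq0.
(* On the residue class [zeta ^ (j n)] is the constant [zeta ^ (j r)]. The vanishing obtained holds
   for all large [n], not only in the class, so that different [r] can be combined at the same
   [n]. *)
apply: (@rat_seq_indep _ X orbit_unbounded w _ v [set n | n %% t = r]%N t) => //.
- by move=> M k M0; exact: orbit_superexp.
- move=> e et; rewrite /v; case: eqVneq => [_|e0]; first exact: orbit_rational_seq.
  apply: (@rat_seq_sum _ X orbit_unbounded
    (fun j n => zeta ^+ (j * r * e) * (theta q (zeta ^+ j * z) ^+ e * l j e n))).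
  move=> j jt; apply: rat_seqZ; apply: rat_seqZ; apply: orbit_rational_seq.
  by apply: lrat => //; rewrite lt0n e0.
- move=> N; exists (N * t + r)%N; last by rewrite /= modnMDl modn_small.
  by rewrite (leq_trans _ (leq_addr _ _)) // leq_pmulr.
near=> n => /= nr; apply: etrans (rel n).
rewrite -(big_mkord xpredT (fun d => v d n * w n ^+ d)) big_ltn // expr0 mulr1.
congr (_ + _); rewrite big_nat [RHS]big_nat; apply: eq_bigr => e /andP[e0 _].
rewrite /v gtn_eqF // mulr_suml; apply: eq_bigr => j _.
have -> : zeta ^+ j * X n = q ^+ n * (zeta ^+ j * z) by rewrite /X mulrCA.
rewrite (theta_iter hq) ?mulf_neq0 ?expf_neq0 //.
have -> : (zeta ^+ j * z) ^+ n = zeta ^+ (j * r) * z ^+ n.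
  rewrite exprMn -!exprM; congr (_ * _).
  by rewrite [(j * n)%N]mulnC [(j * r)%N]mulnC !exprM -nr (prim_expr_mod hzeta).
rewrite exprM /w !exprMn.
move: (theta q _ ^+ e) (zeta ^+ (j * r) ^+ e) (l j e n) => a b c.
by ring.
Unshelve. all: by end_near. Qed.

(** At each large [n] the equations for all [r] hold together, so [prim_root_dft_inj] separates the
    indices [j]; a nonzero theta factor is cancelled and [orbit_rational_eq0] descends to
    [n = 0]. *)
Lemma orbit_vanishing : l0 0%N = 0 /\
  forall j d, (j < t)%N -> (1 <= d < t)%N ->
    theta q (zeta ^+ j * z) != 0 -> l j d 0%N = 0.
Proof.
have t0 := prime_gt0 pt; split.
  by apply: orbit_rational_eq0 => //; exact: (orbit_residue_vanishing t0 t0).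
move=> j d jt /andP[d0 dt] th0.
have hr : \forall n \near \oo, forall r, (r < t)%N ->
    \sum_(j < t) zeta ^+ (j * r * d) * (theta q (zeta ^+ j * z) ^+ d * l j d n) = 0.
  apply: near_forall_lt => r rt.
  by have := orbit_residue_vanishing rt dt; rewrite gtn_eqF.
apply: orbit_rational_eq0; first by apply: lrat => //; rewrite d0.
move: hr; apply: filterS => n hr.
have dt0 : (0 < d < t)%N by rewrite d0.
have := @prim_root_dft_inj _ t d zeta
  (fun j => theta q (zeta ^+ j * z) ^+ d * l j d n) pt hzeta dt0 hr j jt.
move/eqP; rewrite mulf_eq0 expf_eq0 => /orP[/andP[_ th]|/eqP //].
by rewrite th in th0.
Qed.

End OrbitRational.

(** * Elements of kappa(z), and passage from generic points to all regular points *)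

Section KappaZ.
Variables (R : realType) (q : Cplx R).
Hypothesis hq : 1 < `|q|.

Let q1 : 1 < cabs q. Proof. by rewrite -ltcR -cabsE. Qed.

Let q0 : q != 0. Proof. by rewrite -cabs_gt0 (lt_trans _ q1). Qed.

(* The fraction [A / B] representing an element of [kappa(z)], valid pointwise
   outside [T]. *)
Definition regular_off (lam : Cplx R -> Cplx R) (T : set (Cplx R)) :=
  exists n (a b : nat -> Cplx R -> Cplx R), forall z : Cplx R, z != 0 -> ~ T z ->
    [/\ lam z = polyexpr n a z / polyexpr n b z,
        forall i, (i < n)%N -> a i (q * z) = a i z /\ b i (q * z) = b i z,
        {for z, continuous (polyexpr n a)} &
        {for z, continuous (polyexpr n b)}].

Lemma regular_off_sub lam (S T : set (Cplx R)) :
  S `<=` T -> regular_off lam S -> regular_off lam T.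
Proof.
move=> ST [n [a [b h]]]; exists n, a, b => z z0 Tz; apply: h => // Sz.
by apply: Tz; exact: ST.
Qed.

Lemma in_kappa_regular (g : Cplx R -> Cplx R) : in_kappa q g ->
  exists2 S, discrete_in_Cstar S & forall z : Cplx R, z != 0 -> ~ S z ->
    g (q * z) = g z /\ {for z, continuous g}.
Proof.
move=> [[S [dS holo _]] [S' [dS' h]]]; exists (S `|` S').
  exact: discreteU.
move=> z z0 /not_orP[Sz S'z]; split; first exact: h.
by apply/differentiable_continuous/derivable1_diffP; exact: holo.
Qed.

Lemma cvgM_Cplx (F : set_system (Cplx R)) (FF : Filter F)
    (f g : Cplx R -> Cplx R) (l m : Cplx R) :
  f @ F --> l -> g @ F --> m -> (fun y => f y * g y : Cplx R) @ F --> l * m.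
Proof. by move=> fl gm; exact: (cvgM fl gm). Qed.

Lemma cvgD_Cplx (F : set_system (Cplx R)) (FF : Filter F)
    (f g : Cplx R -> Cplx R) (l m : Cplx R) :
  f @ F --> l -> g @ F --> m -> (fun y => f y + g y : Cplx R) @ F --> l + m.
Proof. by move=> fl gm; apply: cvgD; [exact: fl|exact: gm]. Qed.

Lemma polyexpr_continuous n (a : nat -> Cplx R -> Cplx R) (z : Cplx R) :
  (forall i, (i < n)%N -> {for z, continuous (a i)}) ->
  {for z, continuous (polyexpr n a)}.
Proof.
elim: n => [|n IH] h.
  have -> : polyexpr 0 a = cst 0 by apply/funext => y; rewrite /polyexpr big_ord0.
  exact: cst_continuous.
have -> : polyexpr n.+1 a = fun y => polyexpr n a y + a n y * y ^+ n.
  by apply/funext => y; rewrite /polyexpr big_ord_recr.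
have h1 : polyexpr n a @ z --> polyexpr n a z.
  by apply: IH => i lin; apply: h; rewrite ltnS ltnW.
have h2 : a n @ z --> a n z by exact: (h n (ltnSn n)).
have h3 : (fun y : Cplx R => y ^+ n : Cplx R) @ z --> (z ^+ n : Cplx R).
  elim: (n) => [|m IHm].
    exact: (@cst_continuous (Cplx R) (Cplx R) 1 z).
  have hid : (fun y : Cplx R => y) @ z --> z by exact: cvg_id.
  have h3 := cvgM_Cplx _ hid IHm.
  have -> : (fun y : Cplx R => y ^+ m.+1 : Cplx R) = (fun y => y * y ^+ m).
    by apply/funext => y; rewrite exprS.
  by rewrite exprS; exact: h3.
exact: (cvgD_Cplx _ h1 (cvgM_Cplx _ h2 h3)).
Qed.

Lemma in_kappa_z_regular lam : in_kappa_z q lam ->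
  exists2 T, discrete_in_Cstar T & regular_off lam T.
Proof.
move=> [n [a [b [ha hb _ [S [dS hS]]]]]].
have /choice[Sa Sap] : forall i, exists S : set (Cplx R),
    discrete_in_Cstar S /\ forall z : Cplx R, z != 0 -> ~ S z ->
      a i (q * z) = a i z /\ {for z, continuous (a i)}.
  by move=> i; have [Si h1 h2] := in_kappa_regular (ha i); exists Si.
have /choice[Sb Sbp] : forall i, exists S : set (Cplx R),
    discrete_in_Cstar S /\ forall z : Cplx R, z != 0 -> ~ S z ->
      b i (q * z) = b i z /\ {for z, continuous (b i)}.
  by move=> i; have [Si h1 h2] := in_kappa_regular (hb i); exists Si.
exists (S `|` [set z | exists2 i, (i < n)%N & (Sa i `|` Sb i) z]).
  apply: discreteU => //; apply: discrete_bigcup => i _.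
  exact: discreteU (Sap i).1 (Sbp i).1.
exists n, a, b => z z0 /not_orP[Sz nz].
have Saz i : (i < n)%N -> ~ Sa i z by move=> lin h; apply: nz; exists i => //; left.
have Sbz i : (i < n)%N -> ~ Sb i z by move=> lin h; apply: nz; exists i => //; right.
split; first exact: hS.
- by move=> i lin; split; [exact: ((Sap i).2 z z0 (Saz i lin)).1
                          |exact: ((Sbp i).2 z z0 (Sbz i lin)).1].
- by apply: polyexpr_continuous => i lin; exact: ((Sap i).2 z z0 (Saz i lin)).2.
- by apply: polyexpr_continuous => i lin; exact: ((Sbp i).2 z z0 (Sbz i lin)).2.
Qed.

(** Being [q]-invariant, the coefficients keep along the orbit their values at [z], so numerator and
    denominator become polynomials in [q ^ m z]. *)
Lemma regular_off_orbit_rational lam T (z : Cplx R) : regular_off lam T ->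
  z != 0 -> (forall m, ~ T (q ^+ m * z)) ->
  orbit_rational q z (fun m => lam (q ^+ m * z)).
Proof.
move=> [n [a [b h]]] z0 Tz.
have qz0 m : q ^+ m * z != 0 by rewrite mulf_neq0 // expf_neq0.
have inv i m : (i < n)%N -> a i (q ^+ m * z) = a i z /\ b i (q ^+ m * z) = b i z.
  move=> lin; elim: m => [|m [IHa IHb]]; first by rewrite expr0 mul1r.
  have [_ /(_ i lin)[ea eb] _ _] := h _ (qz0 m) (Tz m).
  have e : q ^+ m.+1 * z = q * (q ^+ m * z) by rewrite exprS mulrA.
  by rewrite e ea eb IHa IHb.
exists (\poly_(i < n) a i z), (\poly_(i < n) b i z) => m.
have [-> _ _ _] := h _ (qz0 m) (Tz m).
rewrite !horner_poly /polyexpr; congr (_ / _); apply: eq_bigr => i _.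
  by rewrite (inv i m (ltn_ord i)).1.
by rewrite (inv i m (ltn_ord i)).2.
Qed.

Lemma continuous_neq0 (f : Cplx R -> Cplx R) (z : Cplx R) :
  {for z, continuous f} -> f z != 0 ->
  exists2 r : R, 0 < r & forall y, cabs (y - z) < r -> f y != 0.
Proof.
move=> fz fz0.
have /cvgrPdist_lt h : f @ z --> f z by exact: fz.
have {}h := h `|f z| _; rewrite normr_gt0 in h.
have /nbhs_ballP[e e0 eP] := h fz0.
rewrite /= in e0.
exists (cabs e); first by rewrite cabs_gt0 gt_eqF.
move=> y yz; have : `|f z - f y| < `|f z|.
  by apply: eP; rewrite /ball /= distrC -(gtr0_norm e0) !cabsE ltcR.
by apply: contraTneq => ->; rewrite subr0 ltxx.
Qed.

(** If [lam z != 0], continuity of numerator and denominator keeps [lam] nonzero near [z]. On the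
    real ray through [z], [theta_nonvanishing] and [generic_real] provide a nearby point whose orbit
    avoids [T] and where the theta factor is nonzero, a contradiction. *)
Lemma vanishing_off (lam : Cplx R -> Cplx R) (T : set (Cplx R)) (c : Cplx R) :
  discrete_in_Cstar T -> regular_off lam T -> c != 0 ->
  (forall z : Cplx R, z != 0 -> (forall m, ~ T (q ^+ m * z)) ->
    theta q (c * z) != 0 -> lam z = 0) ->
  forall z, z != 0 -> ~ T z -> lam z = 0.
Proof.
move=> dT [n [a [b h]]] c0 gen z z0 Tz; apply/eqP; apply: contraT => lz.
have [e _ ca cb] := h z z0 Tz.
have /andP[az bz] : (polyexpr n a z != 0) && (polyexpr n b z != 0).
  by move: lz; rewrite e mulf_eq0 invr_eq0 negb_or.
have [r1 r10 r1P] := continuous_neq0 ca az.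
have [r2 r20 r2P] := continuous_neq0 cb bz.
have [r3 r30 r3P] := discreteP dT z0.
pose r := Num.min r1 (Num.min r2 r3).
have r0 : 0 < r by rewrite !lt_min r10 r20.
have zc : 0 < cabs z by rewrite cabs_gt0.
have near_z (y : Cplx R) : y != 0 -> cabs (y - z) < r -> lam y != 0.
  move=> y0; rewrite !lt_min => /and3P[h1 h2 h3].
  have Ty : ~ T y.
    by move=> Ty; apply: Tz; rewrite -(r3P y Ty h3).
  have [-> _ _ _] := h y y0 Ty.
  by rewrite mulf_neq0 ?invr_neq0 ?r1P ?r2P.
(* The sample points [z s x ^ k] satisfy [1 <= s x ^ k <= (1 + delta) ^ 2 < 1 + 4 delta], so they
   lie within [r] of [z]. *)
pose delta := Num.min 1 (r / cabs z / 4).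
have rz : 0 < r / cabs z by rewrite divr_gt0.
have d0 : 0 < delta by rewrite lt_min ltr01 /=; lra.
have d1 : delta <= 1 by rewrite ge_min lexx.
have dr : delta <= r / cabs z / 4 by rewrite ge_min lexx orbT.
have [K [x [x1 xK th]]] : exists (K : nat) (x : R), [/\ 1 < x, x ^+ K.*2 <= 1 + delta &
    forall s : R, 1 <= s <= 2 -> exists2 k : nat, (k <= K.*2)%N &
      theta q (c * z * (s * x ^+ k)%:C%C) != 0].
  by apply: theta_nonvanishing hq _ _ _ _; [rewrite mulf_neq0|rewrite d0].
pose D := K.*2.+1.
(* One index encodes an orbit exponent [i %/ D] and a sample exponent [i %% D]. The suitable [k]
   depends on [s], so [s] has to avoid [T] for all [k <= 2 K] and all shifts at once. *)
pose cs i : Cplx R := q ^+ (i %/ D) * (z * (x ^+ (i %% D))%:C%C).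
have xpos k : 0 < x ^+ k by rewrite exprn_gt0 // (lt_trans _ x1).
have cs0 i : cs i != 0.
  by rewrite !mulf_neq0 ?expf_neq0 // -cabs_gt0 cabs_real // ltW.
have [s /andP[s1 s2] sP] := @generic_real _ T cs 1 (1 + delta) dT cs0 (lexx 1) ltac:(lra).
have [|k kK thk] := th s; first by apply/andP; split; lra.
pose y : Cplx R := z * (s * x ^+ k)%:C%C.
have sx : 0 < s * x ^+ k by rewrite mulr_gt0 //; lra.
have y0 : y != 0 by rewrite mulf_neq0 // -cabs_gt0 cabs_real // ltW.
have Ty m : ~ T (q ^+ m * y).
  have -> : q ^+ m * y = cs (m * D + k)%N * s%:C%C.
    rewrite /cs divnMDl // divn_small // addn0 modnMDl modn_small //.
    by rewrite /y [s * _]mulrC rmorphM !mulrA.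
  exact: sP.
have lamy : lam y = 0.
  apply: gen; [exact: y0|exact: Ty|].
  have -> : c * y = c * z * (s * x ^+ k)%:C%C by rewrite /y mulrA.
  exact: thk.
have : lam y != 0.
  apply: (near_z y y0).
  have -> : y - z = z * (s * x ^+ k)%:C%C - z * 1%:C%C by rewrite /y mulr1.
  rewrite cabs_realM mulrC -ltr_pdivlMr //.
  have xk1 : 1 <= x ^+ k by rewrite exprn_ege1 // ltW.
  have xk2 : x ^+ k <= 1 + delta.
    by rewrite (le_trans _ xK) // ler_weXn2l // ltW.
  move: xk1 xk2 dr rz; move: (x ^+ k) (r / cabs z) => u v u1 u2 dr rz.
  rewrite ger0_norm; last by nra.
  have : s * u <= (1 + delta) * (1 + delta) by apply: ler_pM => //; lra.
  by nra.
by rewrite lamy eqxx.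
Qed.

End KappaZ.

(** * Conclusion, with one exceptional set for all coefficients *)

Unset Implicit Arguments.
Set Strict Implicit.

Theorem theorem6 (R : realType) (q : Cplx R) (hq : 1 < `|q|)
  (t : nat) (ht : prime t) (zeta : Cplx R) (hzeta : t.-primitive_root zeta)
  (lam0 : Cplx R -> Cplx R) (lam : nat -> nat -> Cplx R -> Cplx R)
  (hlam0 : in_kappa_z q lam0)
  (hlam : forall j d, (j < t)%N -> (1 <= d < t)%N -> in_kappa_z q (lam j d))
  (hrel : meq (fun z => lam0 z +
              \sum_(1 <= d < t) \sum_(j < t)
                 lam j d z * theta q (zeta ^+ j * z) ^+ d)
              (fun _ => 0)) :
  meq lam0 (fun _ => 0) /\
  (forall j d, (j < t)%N -> (1 <= d < t)%N -> meq (lam j d) (fun _ => 0)).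
Proof.
have q0 : q != 0 by rewrite -normr_gt0 (lt_trans _ hq).
have t0 := prime_gt0 ht.
have zeta0 : zeta != 0.
  apply/eqP => e; have /eqP := prim_expr_order hzeta.
  by rewrite e expr0n gtn_eqF // eq_sym oner_eq0.
have [T0 dT0 rT0] := in_kappa_z_regular hlam0.
have /choice[Tl Tlp] : forall jd : nat * nat, exists T : set (Cplx R),
    discrete_in_Cstar T /\
    ((jd.1 < t)%N -> (1 <= jd.2 < t)%N -> regular_off q (lam jd.1 jd.2) T).
  move=> [j d] /=; have [jt|jt] := boolP (j < t)%N; last first.
    by exists set0; split; [exact: discrete0|].
  have [dt|dt] := boolP (1 <= d < t)%N; last first.
    by exists set0; split; [exact: discrete0|].
  by have [T dT rT] := in_kappa_z_regular (hlam j d jt dt); exists T.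
have [Tr [dTr hTr]] := hrel.
(* [T] gathers the exceptional sets of all coefficients and of the relation; finiteness of the index
   range keeps it discrete. *)
pose T := T0 `|` Tr `|` [set z | exists2 j, (j < t)%N &
  [set z | exists2 d, (d < t)%N & Tl (j, d) z] z].
have dT : discrete_in_Cstar T.
  apply: discreteU; first exact: discreteU.
  apply: discrete_bigcup => j _; apply: discrete_bigcup => d _.
  exact: (Tlp (j, d)).1.
have r0 : regular_off q lam0 T.
  by apply: regular_off_sub rT0 => z h; left; left.
have rl j d : (j < t)%N -> (1 <= d < t)%N -> regular_off q (lam j d) T.
  move=> jt dt; apply: regular_off_sub ((Tlp (j, d)).2 jt dt) => z h.
  by right; exists j => //; exists d => //; case/andP: dt.
have generic z : z != 0 -> (forall m, ~ T (q ^+ m * z)) ->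
    lam0 z = 0 /\ forall j d, (j < t)%N -> (1 <= d < t)%N ->
      theta q (zeta ^+ j * z) != 0 -> lam j d z = 0.
  move=> z0 Tz.
  have [] := @orbit_vanishing R q z hq z0 t zeta (fun m => lam0 (q ^+ m * z))
    (fun j d m => lam j d (q ^+ m * z)) ht hzeta.
  - exact: regular_off_orbit_rational r0 z0 Tz.
  - by move=> j d jt dt; exact: regular_off_orbit_rational (rl j d jt dt) z0 Tz.
  - move=> m; apply: (hTr (q ^+ m * z)).
      by rewrite mulf_neq0 // expf_neq0.
    by move=> h; apply: (Tz m); left; right.
  by rewrite expr0 mul1r.
split.
  exists T; split => // z z0 Tz.
  apply: (vanishing_off hq dT r0 (oner_neq0 _)) z0 Tz => y y0 Ty _.
  exact: (generic y y0 Ty).1.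
move=> j d jt dt; exists T; split => // z z0 Tz.
have zj0 : zeta ^+ j != 0 by rewrite expf_neq0.
apply: (vanishing_off hq dT (rl j d jt dt) zj0) z0 Tz => y y0 Ty thy.
exact: ((generic y y0 Ty).2 j d jt dt thy).
Qed.
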